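(* Let $n\ge2$ and let $\mathcal{X}=\mathrm{Conf}^*_{\chi_0}(F_n)$ (identified with the poset of quasi-parabolic hyperbolic structures on $F_n$ whose Busemann pseudocharacter is equivalent to $\chi_0$). There exists a copy of $\mathcal{P}(\mathbb{N})$ in $\mathcal{X}$ consisting entirely of non-lamplike structures.
   Context: **The groups.** $F_n$ is the group of all piecewise linear orientation preserving homeomorphisms of $[0,1]$ with all slopes powers of $n$ and breakpoints in $\mathbb{Z}[1/n]$, acting on the right ($x.(gh)=(x.g).h$); $F_n'$ is its commutator subgroup; $\chi_0(g)=\log_n g'(0)$, $\chi_1(g)=\log_n g'(1)$. Conjugation is $x^y=y^{-1}xy$. Fix elements $a_0,\dots,a_{n-1}\in F_n$ such that $a_i$ has support a single open interval $(\ell_i,r_i)$, $\ell_0=0$, $\chi_0(a_0)=1$, $r_{n-1}=1$, $\chi_1(a_{n-1})=1$, $r_{i-1}<\ell_i$ for $1\le i\le n-1$, and the $a_i$ generate the abelianization $F_n/F_n'\cong\mathbb{Z}^n$ (such elements exist). They commute, so $F_n=F_n'\rtimes\mathbb{Z}^n$ with $\mathbb{Z}^n=\langle a_0,\dots,a_{n-1}\rangle$. Put $r=r_0$, $\chi=\chi_0$. **Confining subsets.** $Q\subseteq F_n'$ is $\chi$-confining if $Q=Q^{-1}$ and: $Q^z\subseteq Q$ for all $z\in\mathbb{Z}^n$ with $\chi(z)\ge0$; for every $h\in F_n'$ there is $z\in\mathbb{Z}^n$ with $h^z\in Q$; and there is $z_0\in\mathbb{Z}^n$ with $(Q\cdot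 Q)^{z_0}\subseteq Q$. It is strictly $\chi$-confining if moreover $Q^z\subsetneq Q$ for some $z\in\mathbb{Z}^n$. Let $Z_\chi=\{z\in\mathbb{Z}^n:|\chi(z)|\le1\}$. Write $Q_1\preceq_\chi Q_2$ if the elements of $Q_2$ have uniformly bounded word length with respect to the generating set $Q_1\cup Z_\chi$ of $F_n$; $\mathrm{Conf}^*_\chi(F_n)$ is the induced poset of equivalence classes of strictly $\chi$-confining subsets. The class $[Q]$ corresponds to the hyperbolic structure given by the action of $F_n$ on $\mathrm{Cay}(F_n,Q\cup Z_\chi)$. **Lamplike.** A class in $\mathrm{Conf}^*_\chi(F_n)$ is lamplike if it has a representative all of whose elements fix a common point $t\in(0,r)$, and non-lamplike otherwise. $\mathcal{P}(\mathbb{N})$ is the power set of $\mathbb{N}$ ordered by inclusion; a copy of it in a poset is the image of an order embedding. *)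

(* Defs.v *)
From HB Require Import structures.
From mathcomp Require Import all_boot all_order all_algebra generic_quotient.
From mathcomp Require Import all_classical all_reals all_analysis.

Set Implicit Arguments.
Unset Strict Implicit.
Unset Printing Implicit Defensive.

Import Order.TTheory GRing.Theory Num.Theory.
Import numFieldNormedType.Exports.

Local Open Scope classical_set_scope.
Local Open Scope ring_scope.

Record homeo (T : topologicalType) := Homeo {
  homeo_fun :> T -> T;
  homeo_inv : T -> T;
  homeo_funK : cancel homeo_fun homeo_inv;
  homeo_invK : cancel homeo_inv homeo_fun;
  homeo_fun_cont : continuous homeo_fun;
  homeo_inv_cont : continuous homeo_inv
}.

HB.instance Definition _ (T : topologicalType) := gen_eqMixin (homeo T).
HB.instance Definition _ (T : topologicalType) := gen_choiceMixin (homeo T).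

Section HomeoGroup.
Variable T : topologicalType.
Implicit Types g h : homeo T.

Lemma homeo_eqP g h : homeo_fun g =1 homeo_fun h -> g = h.
Proof.
case: g => f fi fK fiK fc fic; case: h => k ki kK kiK kc kic /= fk.
have {}fk : f = k by apply/funext.
subst k; have fki : fi = ki by apply/funext => x; rewrite -[x in LHS]kiK fK.
by subst ki; congr Homeo; apply: Prop_irrelevance.
Qed.

Lemma continuous_id_homeo : continuous (@idfun T).
Proof. by move=> x. Qed.

Definition homeo_one := @Homeo T idfun idfun (fun=> erefl) (fun=> erefl)
  continuous_id_homeo continuous_id_homeo.

Definition homeo_V g := Homeo (@homeo_invK T g) (@homeo_funK T g)
  (@homeo_inv_cont T g) (@homeo_fun_cont T g).

Lemma homeo_comp_cont (f k : T -> T) :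
  continuous f -> continuous k -> continuous (f \o k).
Proof. by move=> cf ck x; apply: continuous_comp; [exact: ck|exact: cf]. Qed.

(* Right actions: [x.(g * h) = (x.g).h]. *)
Definition homeo_mul g h := @Homeo T (h \o g) (homeo_inv g \o homeo_inv h)
  (can_comp (@homeo_funK T h) (@homeo_funK T g))
  (can_comp (@homeo_invK T g) (@homeo_invK T h))
  (homeo_comp_cont (@homeo_fun_cont T h) (@homeo_fun_cont T g))
  (homeo_comp_cont (@homeo_inv_cont T g) (@homeo_inv_cont T h)).

Lemma homeo_mulA : associative homeo_mul.
Proof. by move=> f g h; apply: homeo_eqP. Qed.

Lemma homeo_mul1 : left_id homeo_one homeo_mul.
Proof. by move=> f; apply: homeo_eqP. Qed.

Lemma homeo_mulr1 : right_id homeo_one homeo_mul.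
Proof. by move=> f; apply: homeo_eqP. Qed.

Lemma homeo_mulV : left_inverse homeo_one homeo_V homeo_mul.
Proof. by move=> f; apply: homeo_eqP => x /=; rewrite homeo_invK. Qed.

Lemma homeo_mulrV : right_inverse homeo_one homeo_V homeo_mul.
Proof. by move=> f; apply: homeo_eqP => x /=; rewrite homeo_funK. Qed.

HB.instance Definition _ := isGroup.Build (homeo T)
  homeo_mulA homeo_mul1 homeo_mulr1 homeo_mulV homeo_mulrV.

End HomeoGroup.

Section GroupSets.
Variable G : groupType.
Implicit Types (S H : set G) (g h : G).

Definition is_subgroup H :=
  [/\ H 1%g, forall g h, H g -> H h -> H (g * h)%g
    & forall g, H g -> H g^-1%g].

Definition generated S : set G := smallest is_subgroup S.

Definition derived H : set G :=
  generated [set c | exists g h, [/\ H g, H h & c = [~ g, h]%g]].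

Definition conjs S (z : G) : set G := [set (q ^ z)%g | q in S].

Definition word_length_le S (k : nat) (g : G) :=
  exists s : seq G, [/\ (size s <= k)%N,
    forall x, x \in s -> S x \/ S x^-1%g & g = (\prod_(x <- s) x)%g].

End GroupSets.

(* [N] and [Z] stand for F_n' and Z^n; [chi] matters only on [Z]. *)
Section Confining.
Variables (R : realType) (G : groupType) (N Z : set G) (chi : G -> R).
Implicit Type Q : set G.

Definition confining Q : Prop :=
  [/\ Q `<=` N,
      [set q^-1%g | q in Q] = Q,
      forall z, Z z -> 0 <= chi z -> conjs Q z `<=` Q,
      forall h, N h -> exists2 z, Z z & Q (h ^ z)%g
    & exists2 z0, Z z0 & conjs [set (p * q)%g | p in Q & q in Q] z0 `<=` Q].

Definition strictly_confining Q : Prop :=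
  confining Q /\ exists2 z, Z z & conjs Q z `<` Q.

Definition Zchi : set G := [set z | Z z /\ `|chi z| <= 1].

Definition conf_le Q1 Q2 : Prop :=
  exists k : nat, forall q, Q2 q -> word_length_le (Q1 `|` Zchi) k q.

Lemma conf_le_refl Q : conf_le Q Q.
Proof.
exists 1%N => q Qq; exists [:: q]; split => //; last by rewrite big_seq1.
by move=> x; rewrite inE => /eqP ->; left; left.
Qed.

Lemma word_length_leV S k (g : G) :
  word_length_le S k g -> word_length_le S k g^-1%g.
Proof.
case=> s [sk Ss ->]; exists (rev [seq x^-1%g | x <- s]).
rewrite size_rev size_map; split => //.
  move=> x; rewrite mem_rev => /mapP[y ys ->]; rewrite invgK.
  by case: (Ss _ ys); [right|left].
elim: s {sk Ss} => [|x s IHs] /=; first by rewrite !big_nil invg1.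
by rewrite big_cons invgM IHs rev_cons -cats1 big_cat big_seq1.
Qed.

Lemma conf_le_trans Q1 Q2 Q3 : conf_le Q1 Q2 -> conf_le Q2 Q3 -> conf_le Q1 Q3.
Proof.
case=> k12 h12 [k23 h23]; exists (k23 * k12.+1)%N => q /h23[s [sk Ss ->]].
have pos x : (Q2 `|` Zchi) x -> word_length_le (Q1 `|` Zchi) k12.+1 x.
  case=> [/h12[t [tk St ->]]|Zx]; first by exists t; split => //; exact: ltnW.
  exists [:: x]; split => //; last by rewrite big_seq1.
  by move=> y; rewrite inE => /eqP ->; left; right.
have {}pos x : x \in s -> word_length_le (Q1 `|` Zchi) k12.+1 x.
  move=> /Ss[/pos //|/pos/word_length_leV]; by rewrite invgK.
suff [t [ts St ->]] :
    word_length_le (Q1 `|` Zchi) (size s * k12.+1) (\prod_(x <- s) x)%g.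
  by exists t; split => //; apply: leq_trans ts _; rewrite leq_mul2r sk orbT.
elim: s {sk Ss} pos => [|x s IHs] pos.
  by exists [::]; split => //; rewrite big_nil.
have [t [tk St xE]] := pos x (mem_head _ _).
have [y ys|u [uk Su sE]] := IHs; first by apply: pos; rewrite inE ys orbT.
exists (t ++ u); split; last by rewrite big_cons big_cat /= -xE -sE.
  by rewrite size_cat /= mulSn leq_add.
by move=> y; rewrite mem_cat => /orP[/St|/Su].
Qed.

Definition conf_rep : Type := [set` [set Q | strictly_confining Q]].
HB.instance Definition _ := Choice.on conf_rep.

Definition conf_equiv (Q1 Q2 : conf_rep) : bool :=
  `[< conf_le (val Q1) (val Q2) /\ conf_le (val Q2) (val Q1) >].

Lemma conf_equiv_refl : reflexive conf_equiv.
Proof. by move=> Q; apply/asboolP; split; exact: conf_le_refl. Qed.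

Lemma conf_equiv_sym : symmetric conf_equiv.
Proof. by move=> Q1 Q2; apply/asboolP/asboolP => -[]. Qed.

Lemma conf_equiv_trans : transitive conf_equiv.
Proof.
move=> Q2 Q1 Q3 /asboolP[h12 h21] /asboolP[h23 h32]; apply/asboolP.
by split; apply: conf_le_trans; eassumption.
Qed.

Canonical conf_equiv_rel :=
  EquivRel conf_equiv conf_equiv_refl conf_equiv_sym conf_equiv_trans.

Definition conf : Type := {eq_quot conf_equiv}%qT.
HB.instance Definition _ := Choice.on conf.
HB.instance Definition _ : EqQuotient _ conf_equiv conf := EqQuotient.on conf.

Definition conf_class (Q : conf_rep) : conf := (\pi_conf Q)%qT.

Lemma conf_classP (Q1 Q2 : conf_rep) : conf_class Q1 = conf_class Q2 <->
  conf_le (val Q1) (val Q2) /\ conf_le (val Q2) (val Q1).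
Proof.
split=> [/eqmodP/asboolP //|h]; by apply/eqmodP/asboolP.
Qed.

Lemma conf_class_repr (X : conf) : conf_class (repr X) = X.
Proof. exact: reprK. Qed.

Definition conf_ord (X Y : conf) : bool :=
  `[< conf_le (val (repr X)) (val (repr Y)) >].

Lemma conf_ord_class (Q1 Q2 : conf_rep) :
  conf_ord (conf_class Q1) (conf_class Q2) <-> conf_le (val Q1) (val Q2).
Proof.
have /conf_classP[h1 h1'] := conf_class_repr (conf_class Q1).
have /conf_classP[h2 h2'] := conf_class_repr (conf_class Q2).
split=> [/asboolP h|h]; last apply/asboolP.
  exact: conf_le_trans h1' (conf_le_trans h h2).
exact: conf_le_trans h1 (conf_le_trans h h2').
Qed.

Lemma conf_ord_refl : reflexive conf_ord.
Proof. by move=> X; apply/asboolP; exact: conf_le_refl. Qed.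

Lemma conf_ord_anti : antisymmetric conf_ord.
Proof.
move=> X Y /andP[/asboolP h /asboolP h'].
by rewrite -(conf_class_repr X) -(conf_class_repr Y); apply/conf_classP.
Qed.

Lemma conf_ord_trans : transitive conf_ord.
Proof.
move=> Y X W /asboolP h /asboolP h'; apply/asboolP.
exact: conf_le_trans h h'.
Qed.

Fact conf_display : Order.disp_t. Proof. exact: Order.Disp tt tt. Qed.

HB.instance Definition _ := Order.Le_isPOrder.Build conf_display conf
  conf_ord_refl conf_ord_anti conf_ord_trans.

End Confining.

(* A homeomorphism of [0,1] fixing 0 and 1 is encoded by its extension to the
   line by the identity. *)
Section Thompson.
Variables (R : realType) (n : nat).
Implicit Types g z : homeo R.

Definition nadic : set R :=
  [set x | exists (m : int) (k : nat), x = m%:~R / n%:R ^+ k].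

(* [0 :: s] lists the subdivision points of [0,1] in increasing order. *)
Definition nadic_piecewise_linear (f : R -> R) : Prop :=
  exists s : seq R,
    [/\ path <%R 0 s, last 0 s = 1, forall x, x \in s -> nadic x
      & forall i, (i < size s)%N -> exists k : int,
          forall x, x \in `[(0 :: s)`_i, s`_i] ->
            f x = f (0 :: s)`_i + n%:R ^ k * (x - (0 :: s)`_i)].

Definition thompson : set (homeo R) :=
  [set g | [/\ forall x, x \notin `[0, 1] -> g x = x,
               {homo g : x y / x < y}
             & nadic_piecewise_linear g]].

Definition thompson' : set (homeo R) := derived thompson.

(* One-sided derivatives: g is the identity outside [0,1]. *)
Definition rderiv (f : R -> R) (x : R) : R :=
  lim (h^-1 * (f (x + h) - f x) @[h --> 0^'+]).

Definition lderiv (f : R -> R) (x : R) : R :=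
  lim (h^-1 * (f (x + h) - f x) @[h --> 0^'-]).

Definition chi0 g : R := ln (rderiv g 0) / ln n%:R.
Definition chi1 g : R := ln (lderiv g 1) / ln n%:R.

(* Only the values at indices [i < n] of the sequences [a], [l], [r] matter. *)
Definition lattice (a : nat -> homeo R) : set (homeo R) :=
  generated [set a i | i in `I_n].

Record standard_generators (a : nat -> homeo R) (l r : nat -> R) : Prop := {
  sg_thompson : forall i, (i < n)%N -> thompson (a i);
  sg_lt : forall i, (i < n)%N -> l i < r i;
  sg_supp : forall i, (i < n)%N ->
    [set x | a i x != x] = [set` `]l i, r i[];
  sg_l0 : l 0%N = 0;
  sg_chi0 : chi0 (a 0%N) = 1;
  sg_rlast : r n.-1 = 1;
  sg_chi1 : chi1 (a n.-1) = 1;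
  sg_sep : forall i, (0 < i < n)%N -> r i.-1 < l i;
  (* the classes of the a_i generate F_n / F_n' *)
  sg_gen : forall g, thompson g ->
    exists h z, [/\ thompson' h, lattice a z & g = (h * z)%g]
}.

Definition conf_chi0 (a : nat -> homeo R) :=
  conf thompson' (lattice a) chi0.

Definition lamplike (a : nat -> homeo R) (r0 : R) (X : conf_chi0 a) : Prop :=
  exists2 Q : conf_rep thompson' (lattice a) chi0, conf_class Q = X &
    exists t : R, 0 < t < r0 /\ forall q : homeo R, val Q q -> q t = t.

End Thompson.
HB.instance Definition _ R n a := Order.POrder.on (@conf_chi0 R n a).

(* Main.v *)
Require Import Defs.
From mathcomp Require Import all_boot all_order all_algebra.
From mathcomp Require Import all_classical all_reals all_analysis.
From mathcomp Require Import zify ring lra.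
Import numFieldNormedType.Exports.

(** Near 0 the generator a_0 is multiplication by n, so conjugation by a_0^m
    rescales the graph of a homeomorphism by the factor n^m. A bound on the
    displacement |h x - x| of an order higher than one in x therefore becomes
    easier to satisfy under conjugation by a_0. Let P be a set of marks in
    [0,1] that contains 0 and is stable under division by n, let t > 0 be
    small, and let Q_P ([pinned]) be the set of the h in F_n' such that h and
    its inverse satisfy

      |h x - x| <= x (x^2 + |x - p|)    for all x in [0,t] and p in P.

    This set is confining ([pinned_confining]): it is preserved by conjugation
    by elements of nonnegative chi_0; the bound is Lipschitz in x, so a product
    of two elements satisfies it up to a factor 4, which conjugation by a_0^2
    absorbs; and an element of F_n' is the identity near 0, so that a
    power of a_0 conjugates it into Q_P. It is strictly confining because it
    contains elements that are not the identity on [0,t].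

    To a set A of integers attach the set of marks P_A that consists of 0 and of
    the points n^-i (1 - n^-(j+2)) with j in A ([marks]). The larger A, the
    smaller Q_A. Conversely, a comparison of the class of Q_A with that of Q_B
    puts Q_B into a conjugate of Q_A by a fixed power a_0^-K, up to factors that
    are the identity near 0 ([bounded_word_conj], [conf_le_conj]). If j is in A
    but not in B, the marks of j are far from those of B, relatively to their
    own size x, so that Q_B contains elements that move them by a fixed multiple
    of x^2 ([mark_displaced]); in Q_A they move by at most x^3, and the
    conjugation by a_0^-K only multiplies this bound by n^(2K). This is a
    contradiction when x is small ([pinned_marks_le]).

    Finally, if some Q in the class of Q_A consisted of elements that fix a
    point s of (0,r_0), the same comparison would make every element of Q_A
    fix the preimage of s by a_0^k for all large k. But the bound allows a
    displacement x^3 at every point x, so Q_A has no fixed point near 0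
    ([pinned_not_fixing]).

    The elements of F_n' with a prescribed small displacement are commutators of
    a_0 with piecewise linear bumps ([bump_exists], [pinned_bump]). *)

Set Implicit Arguments.
Unset Strict Implicit.
Unset Printing Implicit Defensive.

Import Order.TTheory GRing.Theory Num.Theory.

Local Open Scope classical_set_scope.
Local Open Scope ring_scope.

(** * Derived subgroups and confining sets in an abstract group *)

Section SubgroupTheory.
Variable G : groupType.
Implicit Types (S H : set G) (g h z : G).

Lemma generated_subgroup S : is_subgroup (generated S).
Proof.
split=> [A [[A1 _ _] _] //|g h gS hS A AS|g gS A AS].
- by have [[_ AM _] _] := AS; apply: AM; [exact: gS|exact: hS].
- by have [[_ _ AV] _] := AS; apply: AV; exact: gS.
Qed.

Lemma generated_incl S : S `<=` generated S.
Proof. by move=> g Sg A [_]; exact. Qed.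

Lemma generated_min S H : is_subgroup H -> S `<=` H -> generated S `<=` H.
Proof. by move=> sH SH g; apply. Qed.

Lemma subgroupX H g k : is_subgroup H -> H g -> H (g ^+ k)%g.
Proof.
move=> [H1 HM _] Hg; elim: k => [|k IHk]; first by rewrite expg0.
by rewrite expgS; apply: HM.
Qed.

Lemma subgroupJ H g h : is_subgroup H -> H g -> H h -> H (g ^ h)%g.
Proof. by move=> [_ HM HV] Hg Hh; apply: (HM _ _ (HV _ Hh)); apply: HM. Qed.

Lemma derived_comm H g h : H g -> H h -> derived H [~ g, h]%g.
Proof. by move=> Hg Hh; apply: generated_incl; exists g, h. Qed.

Lemma derived_conj H g z :
  is_subgroup H -> H z -> derived H g -> derived H (g ^ z)%g.
Proof.
move=> sH Hz; have [D1 DM DV] : is_subgroup (derived H).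
  exact: generated_subgroup.
apply: (@generated_min _ [set g | derived H (g ^ z)%g]); first split => /=.
- by rewrite conj1g.
- by move=> x y Dx Dy; rewrite conjMg; apply: DM.
- by move=> x Dx; rewrite conjVg; apply: DV.
- move=> _ [x [y [Hx Hy ->]]] /=; rewrite conjRg.
  by apply: derived_comm; apply: subgroupJ.
Qed.

End SubgroupTheory.

Section ConfiningTheory.
Variables (R : realType) (G : groupType) (N Z : set G) (chi : G -> R).
Hypotheses (sZ : is_subgroup Z)
  (chiM : forall z w, Z z -> Z w -> chi (z * w)%g = chi z + chi w).
Implicit Types (Q : set G) (g h z w : G).

Lemma chi_inv z : Z z -> chi z^-1%g = - chi z.
Proof.
have [Z1 _ ZV] := sZ; move=> Zz.
have chi1 : chi 1%g = 0 by have := chiM Z1 Z1; rewrite mulg1; lra.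
by have := chiM Zz (ZV _ Zz); rewrite mulgV chi1; lra.
Qed.

Lemma Zchi_inv z : Zchi Z chi z -> Zchi Z chi z^-1%g.
Proof.
by move=> [Zz ?]; split; [case: sZ => _ _; exact|rewrite chi_inv ?normrN].
Qed.

Lemma confiningV Q g : confining N Z chi Q -> Q g -> Q g^-1%g.
Proof. by move=> [_ QV _ _ _] Qg; rewrite -QV; exists g. Qed.

Lemma confiningJ Q g z :
  confining N Z chi Q -> Z z -> 0 <= chi z -> Q g -> Q (g ^ z)%g.
Proof. by move=> [_ _ QJ _ _] Zz z0 Qg; apply: (QJ z) => //; exists g. Qed.

Lemma confining1 Q : N 1%g -> confining N Z chi Q -> Q 1%g.
Proof. by move=> N1 [_ _ _ QN _]; have [z _] := QN _ N1; rewrite conj1g. Qed.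

(** The letters taken from [Z] can be pushed to the right end of a word, which
    conjugates the letters taken from [Q] by elements of bounded [chi]. A common
    conjugation by [w] with [chi w] large undoes this and also absorbs the
    boundedly many products, since [(Q Q) ^ z0] is contained in [Q]. So being at
    bounded word length forces membership in a fixed conjugate of [Q], up to a
    factor in [Z]: this turns the comparison of confining sets into an
    inclusion. *)
Lemma bounded_word_conj Q k : N 1%g -> confining N Z chi Q ->
  exists c : R, forall g, word_length_le (Q `|` Zchi Z chi) k g ->
    exists2 z, Z z & forall w, Z w -> c <= chi w -> Q ((g * z^-1) ^ w)%g.
Proof.
move=> N1 cQ; have [Z1 ZM ZV] := sZ.
have [_ _ _ _ [z0 Zz0 QQ]] := cQ.
elim: k => [|k [c IHk]].
  exists 0 => g [s [+ _ ->]]; rewrite leqn0 => /nilP ->.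
  exists 1%g => // w _ _; rewrite big_nil invg1 mulg1 conj1g.
  exact: confining1.
exists (Num.max c 0 + Num.max 1 (chi z0)) => g [s [sk Ss ->]].
have cm : c <= Num.max c 0 by rewrite le_max lexx.
have m0 : 0 <= Num.max c 0 by rewrite le_max lexx orbT.
have m1 : 1 <= Num.max 1 (chi z0) by rewrite le_max lexx.
have mz : chi z0 <= Num.max 1 (chi z0) by rewrite le_max lexx orbT.
set c0 := Num.max c 0 in cm m0 *; set c1 := Num.max 1 _ in m1 mz *.
case: s sk Ss => [|x s] /= sk Ss.
  exists 1%g => // w _ _; rewrite big_nil invg1 mulg1 conj1g.
  exact: confining1.
have [|z Zz zQ] := IHk (\prod_(y <- s) y)%g.
  by exists s; split => // y ys; apply: Ss; rewrite inE ys orbT.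
rewrite big_cons; set h := (\prod_(y <- s) y)%g in zQ *.
have [Qx|Zx] : Q x \/ Zchi Z chi x.
  have [|[|]|[|]] := Ss x; first exact: mem_head.
  - by left.
  - by right.
  - by move=> /(confiningV cQ); rewrite invgK; left.
  - by move=> /Zchi_inv; rewrite invgK; right.
- exists z => // w Zw cw.
  have Zv : Z (w * z0^-1)%g by apply: ZM => //; apply: ZV.
  have cv : chi (w * z0^-1)%g = chi w - chi z0.
    by rewrite chiM ?chi_inv //; exact: ZV.
  rewrite -mulgA -(mulgVK z0 w) conjgM; apply: QQ; eexists; last by [].
  rewrite conjMg; exists (x ^ (w * z0^-1))%g.
    by apply: (confiningJ cQ) => //; lra.
  by exists ((h * z^-1) ^ (w * z0^-1))%g => //; apply: zQ => //; lra.
- case: (Zx) => {}Zx; rewrite ler_norml => /andP[x1 x2].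
  exists (x * z)%g; first exact: ZM.
  move=> w Zw cw.
  have -> : ((x * h) * (x * z)^-1)%g = ((h * z^-1) ^ x^-1)%g.
    by rewrite invgM conjgE invgK !mulgA.
  rewrite -conjgM; apply: zQ; first by apply: ZM => //; apply: ZV.
  by rewrite chiM ?chi_inv //; [lra|exact: ZV].
Qed.

End ConfiningTheory.

(** * The group F_n *)

Section HomeoEval.
Variable T : topologicalType.
Implicit Types (g h : homeo T) (x : T).

Lemma homeoM g h x : (g * h)%g x = h (g x). Proof. by []. Qed.

Lemma homeoKV g x : g (g^-1%g x) = x. Proof. exact: homeo_invK. Qed.

Lemma homeoVK g x : g^-1%g (g x) = x. Proof. exact: homeo_funK. Qed.

Lemma homeoJ g h x : (g ^ h)%g (h x) = h (g x).
Proof. by rewrite /= homeo_funK. Qed.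

End HomeoEval.

Section ThompsonGroup.
Variables (R : realType) (n : nat).
Hypothesis n_ge2 : (2 <= n)%N.
Implicit Types (g h : homeo R) (x y : R).
Local Notation nadic := (@nadic R n).
Local Notation thompson := (@thompson R n).

Lemma base_ge2 : 2 <= n%:R :> R. Proof. by rewrite ler_nat. Qed.

Lemma base_gt0 : 0 < n%:R :> R. Proof. by have := base_ge2; lra. Qed.

Lemma base_neq0 : n%:R != 0 :> R. Proof. by rewrite gt_eqF ?base_gt0. Qed.

Lemma baseX_gt0 k : 0 < n%:R ^+ k :> R. Proof. exact: exprn_gt0 base_gt0. Qed.

Lemma baseX_unbounded (x : R) : exists m, x <= n%:R ^+ m.
Proof.
have [m xm] : exists m, x <= m%:R.
  by exists (Num.bound `|x|); apply: le_trans (ler_norm x) (ltW (archi_boundP _)).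
exists m; apply: le_trans xm _.
by rewrite -natrX ler_nat ltnW // ltn_expl.
Qed.

Lemma nadicD x y : nadic x -> nadic y -> nadic (x + y).
Proof.
move=> [m [k ->]] [m' [k' ->]]; exists (m * n%:R ^+ k' + m' * n%:R ^+ k), (k + k')%N.
rewrite rmorphD !rmorphM !rmorphXn /= !rmorph_nat exprD.
by field; rewrite !expf_neq0 ?base_neq0.
Qed.

Lemma nadicN x : nadic x -> nadic (- x).
Proof. by move=> [m [k ->]]; exists (- m), k; rewrite rmorphN mulNr. Qed.

Lemma nadicM x y : nadic x -> nadic y -> nadic (x * y).
Proof.
move=> [m [k ->]] [m' [k' ->]]; exists (m * m'), (k + k')%N.
by rewrite rmorphM /= exprD invfM mulrACA.
Qed.

Lemma nadic_int (m : int) : nadic m%:~R.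
Proof. by exists m, 0%N; rewrite expr0 divr1. Qed.

Lemma nadic_expz (k : int) : nadic (n%:R ^ k).
Proof.
case: k => k; first by exists (n%:R ^+ k), 0%N; rewrite expr0 divr1 rmorphXn /= rmorph_nat.
by exists 1, k.+1; rewrite mul1r.
Qed.

Lemma piece_around (s : seq R) x : last 0 s = 1 -> 0 < x <= 1 ->
  exists2 i, (i < size s)%N & (0 :: s)`_i < x <= s`_i.
Proof.
move=> s_last /andP[x0 x1]; pose i := find (fun y => x <= y) s.
have i_lt : (i < size s)%N.
  rewrite -has_find; apply/hasP; exists 1 => //.
  case: (s) s_last => [|y s'] /= E; last by rewrite -E; exact: mem_last.
  by have := @ltr01 R; rewrite -E ltxx.
exists i => //; apply/andP; split; last first.
  by have := @nth_find _ 0 (fun y => x <= y) s; rewrite has_find; exact.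
case E : i i_lt => [|j] //= j_lt.
have := @before_find _ 0 (fun y => x <= y) s j.
by rewrite -/i E ltnSn => /(_ isT)/negbT; rewrite -ltNge.
Qed.

(** A form of piecewise linearity in which the breakpoints need be neither
    sorted nor in [0,1]: lists of breakpoints can then be merged by mere
    concatenation. *)
Definition affine_off (f : R -> R) (s : seq R) := forall u v : R,
  0 <= u -> u < v -> v <= 1 -> (forall x, x \in s -> ~~ (u < x < v)) ->
  exists k : int, forall x, u <= x <= v -> f x = f u + n%:R ^ k * (x - u).

(** From left to right, a subinterval without breakpoints in its interior lies
    in one piece of the subdivision; from right to left, the breakpoints in
    ]0,1[ are sorted and deprived of repetitions. *)
Lemma nadic_plP (f : R -> R) : nadic_piecewise_linear n f <->
  exists2 s, (forall x, x \in s -> nadic x) & affine_off f s.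
Proof.
split=> [[s [s_path s_last s_nadic s_aff]]|[s s_nadic s_aff]].
  exists s => // u v u0 uv v1 sN.
  have [|i i_lt /andP[iv vi]] := @piece_around s v s_last.
    by rewrite (le_lt_trans u0 uv).
  have iu : (0 :: s)`_i <= u.
    case: i iv i_lt {vi} => [|i] //= iv i_lt.
    have := sN s`_i; rewrite mem_nth 1?ltnW // => /(_ isT).
    by rewrite iv andbT -leNgt.
  have [k kE] := s_aff _ i_lt; exists k => x /andP[ux xv].
  rewrite (kE x) ?(kE u) ?in_itv /=; first by ring.
    by rewrite iu (le_trans (ltW uv) vi).
  by rewrite (le_trans iu ux) (le_trans xv vi).
pose s1 := sort <=%O (undup [seq x <- s | 0 < x < 1]).
have s1E x : (x \in s1) = (x \in s) && (0 < x < 1).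
  by rewrite mem_sort mem_undup mem_filter andbC.
pose s2 := rcons s1 1.
have s1_path : path <%R 0 s1.
  rewrite path_sortedE; last exact: lt_trans.
  apply/andP; split; first by apply/allP => x; rewrite s1E => /and3P[].
  by rewrite lt_sorted_uniq_le sort_uniq undup_uniq; exact: sort_le_sorted.
have s2_path : path <%R 0 s2.
  rewrite rcons_path s1_path /=; have := mem_last 0 s1.
  by rewrite inE s1E => /orP[/eqP ->|/and3P[]].
have s2E x : x \in 0 :: s2 -> 0 <= x <= 1.
  rewrite inE mem_rcons inE s1E => /or3P[/eqP ->|/eqP ->|].
  - by rewrite lexx ler01.
  - by rewrite lexx ler01.
  - by move=> /and3P[_ /ltW -> /ltW ->].
exists s2; split => //; first by rewrite last_rcons.
  move=> x; rewrite mem_rcons inE s1E => /orP[/eqP ->|/andP[/s_nadic //]].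
  exact: (nadic_int 1).
move=> i i_lt.
have /s2E/andP[u0 _] : (0 :: s2)`_i \in 0 :: s2 by apply: mem_nth => /=; exact: ltnW.
have /s2E/andP[_ v1] : s2`_i \in 0 :: s2 by rewrite inE mem_nth ?orbT.
have uv : (0 :: s2)`_i < s2`_i by move/(pathP 0): s2_path; exact.
have [|k kE] := s_aff _ _ u0 uv v1; last by exists k => x; rewrite in_itv; exact: kE.
move=> x xs; apply/negP => /andP[ux xv].
have xs2 : x \in s2.
  rewrite mem_rcons inE s1E xs /= (lt_le_trans xv v1) (le_lt_trans u0 ux).
  by rewrite orbT.
have xE := nth_index 0 xs2; move: ux xv; rewrite -xE; set j := index x s2.
have j_lt : (j < size s2)%N by rewrite index_mem.
have s2_mono := lt_sorted_ltn_nth 0 (s2_path : sorted <%R (0 :: s2)).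
rewrite (s2_mono i j.+1) ?inE /= 1?ltnS ?(ltnW i_lt) // => ij.
rewrite (s2_mono j.+1 i.+1) ?inE //= => ji.
by move: ji; rewrite ltnS ltnNge ij.
Qed.

Section OneElement.
Variable g : homeo R.
Hypothesis Fg : thompson g.

Lemma thompson_lt : {mono g : x y / x < y}.
Proof. by apply: leW_mono; apply: le_mono; case: Fg. Qed.

Lemma thompson_le : {mono g : x y / x <= y}.
Proof. by apply: le_mono; case: Fg. Qed.

Lemma thompson_outside x : x \notin `[0, 1] -> g x = x.
Proof. by case: Fg => + _ _; apply. Qed.

Lemma homeo_inj : injective g. Proof. exact: can_inj (homeoVK g). Qed.

Lemma thompson_0 : g 0 = 0.
Proof.
case: (ltgtP (g 0) 0) => // g0.
  by apply: homeo_inj; rewrite thompson_outside // in_itv /= leNgt g0.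
have y0 : g^-1%g 0 < 0 by rewrite -thompson_lt homeoKV.
have := homeoKV g 0; rewrite thompson_outside => [yE|].
  by move: y0; rewrite yE ltxx.
by rewrite in_itv /= leNgt y0.
Qed.

Lemma thompson_1 : g 1 = 1.
Proof.
case: (ltgtP (g 1) 1) => // g1; last first.
  by apply: homeo_inj; rewrite thompson_outside // in_itv /= (leNgt _ 1) g1 andbF.
have y1 : 1 < g^-1%g 1 by rewrite -thompson_lt homeoKV.
have := homeoKV g 1; rewrite thompson_outside => [yE|].
  by move: y1; rewrite yE ltxx.
by rewrite in_itv /= (leNgt _ 1) y1 andbF.
Qed.

Lemma thompson_itv x : (0 <= g x <= 1) = (0 <= x <= 1).
Proof.
by rewrite -(thompson_le 0 x) -(thompson_le x 1) thompson_0 thompson_1.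
Qed.

(** Both directions are needed: the breakpoints of [g * h] include preimages by
    [g] of breakpoints of [h], and those of the inverse are images. Starting from
    [g 0 = 0], the images of the successive breakpoints are n-adic, and on each
    piece [g] and its inverse have slope a power of [n]. *)
Lemma thompson_nadic x : nadic x <-> nadic (g x).
Proof.
case: (boolP (x \in `[0, 1])) => [|/thompson_outside -> //].
rewrite in_itv /= => /andP[x0 x1].
have [_ _ [s [s_path s_last s_nadic s_aff]]] := Fg.
have s_nadic0 i : (i <= size s)%N -> nadic (0 :: s)`_i.
  case: i => [_|i i_lt]; first exact: (nadic_int 0).
  by apply: s_nadic; exact: mem_nth.
have sg_nadic i : (i <= size s)%N -> nadic (g (0 :: s)`_i).
  elim: i => [_|i IHi i_lt]; first by rewrite thompson_0; exact: (nadic_int 0).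
  have [k kE] := s_aff _ i_lt.
  have uv : (0 :: s)`_i < s`_i by move/(pathP 0): s_path; exact.
  rewrite /= kE; last by rewrite in_itv /= lexx ltW.
  apply: nadicD; first exact: IHi (ltnW i_lt).
  apply: nadicM; first exact: nadic_expz.
  apply: nadicD; last by apply: nadicN; exact: s_nadic0 (ltnW i_lt).
  exact: (s_nadic0 i.+1).
have [->|x_neq0] := eqVneq x 0; first by rewrite thompson_0.
have [|i i_le /andP[ix xi]] := @piece_around s x s_last.
  by rewrite lt_neqAle eq_sym x_neq0 x0.
have [k kE] := s_aff _ i_le; have := sg_nadic i (ltnW i_le).
have := s_nadic0 i (ltnW i_le); rewrite (kE x); last by rewrite in_itv /= ltW.
set u := (0 :: s)`_i => un gun; split=> h.
  apply: nadicD => //; apply: nadicM; first exact: nadic_expz.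
  by apply: nadicD => //; apply: nadicN.
have -> : x = u + n%:R ^ (- k) * ((g u + n%:R ^ k * (x - u)) + - g u).
  by rewrite -invr_expz; field; rewrite expfz_neq0 // base_neq0.
apply: nadicD => //; apply: nadicM; first exact: nadic_expz.
by apply: nadicD => //; apply: nadicN.
Qed.

End OneElement.

Lemma thompson_subgroup : is_subgroup thompson.
Proof.
split.
- split=> //.
  by apply/nadic_plP; exists [::] => // u v *; exists 0 => x _ /=; ring.
- move=> g h Fg Fh; split.
  + by move=> x x01 /=; rewrite !thompson_outside // thompson_outside.
  + by move=> x y xy /=; rewrite !thompson_lt.
  + have [_ _ /nadic_plP[s s_nadic s_aff]] := Fg.
    have [_ _ /nadic_plP[t t_nadic t_aff]] := Fh.
    apply/nadic_plP; exists (s ++ [seq g^-1%g x | x <- t]).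
      move=> x; rewrite mem_cat => /orP[/s_nadic //|/mapP[y /t_nadic yn ->]].
      by apply/(thompson_nadic Fg); rewrite homeoKV.
    move=> u v u0 uv v1 noB.
    have [x xs|k kE] := s_aff u v u0 uv v1; first by apply: noB; rewrite mem_cat xs.
    have := thompson_itv Fg u; rewrite u0 (le_trans (ltW uv) v1) => /andP[gu0 _].
    have := thompson_itv Fg v; rewrite v1 (le_trans u0 (ltW uv)) => /andP[_ gv1].
    have guv : g u < g v by rewrite thompson_lt.
    have [x xt|k' k'E] := t_aff _ _ gu0 guv gv1.
      have := noB (g^-1%g x); rewrite mem_cat map_f ?orbT // => /(_ isT).
      by rewrite -(thompson_lt Fg u) -(thompson_lt Fg _ v) homeoKV.
    exists (k' + k) => x xuv /=.
    have gxuv : g u <= g x <= g v by rewrite !thompson_le.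
    rewrite (k'E _ gxuv) (kE _ xuv).
    by rewrite expfzDr ?base_neq0 //; ring.
- move=> g Fg; split.
  + by move=> x x01; apply: (@homeo_inj g); rewrite homeoKV thompson_outside.
  + by move=> x y xy; rewrite -(thompson_lt Fg) !homeoKV.
  + have [_ _ /nadic_plP[s s_nadic s_aff]] := Fg.
    apply/nadic_plP; exists [seq g x | x <- s].
      by move=> x /mapP[y /s_nadic yn ->]; exact: (thompson_nadic Fg y).1.
    move=> u v u0 uv v1 noB.
    have := thompson_itv Fg (g^-1%g u); rewrite homeoKV u0 (le_trans (ltW uv) v1).
    move=> /esym/andP[gu0 _].
    have := thompson_itv Fg (g^-1%g v); rewrite homeoKV v1 (le_trans u0 (ltW uv)).
    move=> /esym/andP[_ gv1].
    have guv : g^-1%g u < g^-1%g v by rewrite -(thompson_lt Fg) !homeoKV.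
    have [x xs|k kE] := s_aff _ _ gu0 guv gv1.
      have := noB _ (map_f g xs); rewrite -{1}(homeoKV g u) -{1}(homeoKV g v).
      by rewrite !(thompson_lt Fg).
    exists (- k) => x xuv.
    have := kE (g^-1%g x); rewrite -{1}(thompson_le Fg).
    rewrite -[X in _ && X](thompson_le Fg) !homeoKV => /(_ xuv) xE.
    rewrite [in RHS]xE -invr_expz; field; by rewrite expfz_neq0 // base_neq0.
Qed.

End ThompsonGroup.

(** * Germs at 0 and the character chi_0 *)

Section Germs.
Variables (R : realType) (n : nat).
Hypothesis n_ge2 : (2 <= n)%N.
Implicit Types (g h : homeo R) (k l : int).

Definition germ0 g k := exists2 e : R, 0 < e &
  forall x, 0 <= x <= e -> g x = n%:R ^ k * x.

Let nk_gt0 k : 0 < n%:R ^ k :> R.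
Proof. apply: exprz_gt0; exact: base_gt0. Qed.

Let n_neq0 : n%:R != 0 :> R. Proof. exact: base_neq0. Qed.

Lemma thompson_germ0 g : thompson n g -> exists k, germ0 g k.
Proof.
move=> Fg; have g0 := thompson_0 Fg; have [_ _ [s [sp sl _ sa]]] := Fg.
case: s sp sl sa => [_ /= sl|x s /= /andP[x0 _] _ /(_ 0%N isT)[k kE]].
  by have := @ltr01 R; rewrite sl ltxx.
exists k, x => // y yx; rewrite kE ?in_itv //= g0; ring.
Qed.

Lemma germ0M g h k l : germ0 g k -> germ0 h l -> germ0 (g * h)%g (k + l).
Proof.
move=> [e e0 ge] [f f0 hf]; exists (Num.min e (f / n%:R ^ k)).
  by rewrite lt_min e0 divr_gt0.
move=> x /andP[x0]; rewrite le_min => /andP[xe xf] /=.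
rewrite ge ?x0 // hf; first by rewrite mulrA -expfzDr // addrC.
by rewrite mulr_ge0 ?(ltW (nk_gt0 _)) //= mulrC -ler_pdivlMr.
Qed.

Lemma germ0V g k : germ0 g k -> germ0 g^-1%g (- k).
Proof.
move=> [e e0 ge]; exists (n%:R ^ k * e); first exact: mulr_gt0.
move=> x /andP[x0 xe]; rewrite -invr_expz.
apply: (@homeo_inj _ g); rewrite homeoKV ge.
  by rewrite mulVKf // gt_eqF.
by rewrite mulr_ge0 ?invr_ge0 ?(ltW (nk_gt0 _)) //= ler_pdivrMl.
Qed.

Lemma germ0_1 : germ0 1%g 0.
Proof. by exists 1 => // x _; rewrite expr0z mul1r. Qed.

Lemma ln_exprz (x : R) k : 0 < x -> ln (x ^ k) = k%:~R * ln x.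
Proof.
move=> x0; case: k => k; first by rewrite lnXn // mulr_natl.
by rewrite NegzE -exprnN lnV ?lnXn ?posrE ?exprn_gt0 // mulrNz mulNr mulr_natl.
Qed.

Lemma germ0_chi0 g k : germ0 g k -> chi0 n g = k%:~R.
Proof.
move=> [e e0 ge]; have g0 : g 0 = 0 by rewrite ge ?mulr0 // lexx ltW.
have -> : chi0 n g = ln (n%:R ^ k) / ln n%:R.
  congr (ln _ / _); apply: cvg_lim => //.
  apply: cvg_near_cst; near=> h; rewrite add0r g0 subr0 ge.
    by rewrite mulrCA mulVf ?mulr1 // gt_eqF.
  by apply/andP; split; apply: ltW.
rewrite ln_exprz ?base_gt0 // mulfK // gt_eqF // ln_gt0 //.
by have := @base_ge2 R n n_ge2; lra.
Unshelve. all: by end_near. Qed.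

Lemma chi0M g h : thompson n g -> thompson n h ->
  chi0 n (g * h)%g = chi0 n g + chi0 n h.
Proof.
move=> /thompson_germ0[k gk] /thompson_germ0[l hl].
rewrite (germ0_chi0 gk) (germ0_chi0 hl) (germ0_chi0 (germ0M gk hl)).
by rewrite intrD.
Qed.

(** The germs at 0 are linear maps, hence commute: a commutator is the identity
    near 0. *)
Lemma thompson'_germ0 g : thompson' n g -> germ0 g 0.
Proof.
apply: (@generated_min _ _ [set g | germ0 g 0]); first split => /=.
- exact: germ0_1.
- by move=> x y gx gy; rewrite -(addr0 0); apply: germ0M.
- by move=> x gx; rewrite -oppr0; apply: germ0V.
move=> _ [x [y [/thompson_germ0[k xk] /thompson_germ0[l yl] ->]]] /=.
have := germ0M (germ0V xk) (germ0M (germ0V yl) (germ0M xk yl)).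
by rewrite [X in germ0 _ X](_ : _ = 0) //; ring.
Qed.

Lemma thompson'_chi0 g : thompson' n g -> chi0 n g = 0.
Proof. by move=> /thompson'_germ0/germ0_chi0 ->. Qed.

End Germs.

(** * The lattice generated by the a_i, near 0 *)

Section Lattice.
Variables (R : realType) (n : nat) (a : nat -> homeo R) (l r : nat -> R).
Hypotheses (n_ge2 : (2 <= n)%N) (a_std : standard_generators n a l r).
Implicit Types (z : homeo R) (x : R).

Let n_gt0 : (0 < n)%N. Proof. exact: ltnW. Qed.

Lemma support_gen i x : (i < n)%N -> (a i x != x) = (l i < x < r i).
Proof.
move=> i_lt; have := sg_supp a_std i_lt; move/(congr1 (fun A => A x)) => /=.
by rewrite in_itv /= => E; apply/idP/idP; rewrite E.
Qed.

Lemma r0_gt0 : 0 < r 0%N.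
Proof. by rewrite -(sg_l0 a_std); apply: (sg_lt a_std). Qed.

Lemma gen0_fix_r0 : a 0%N (r 0%N) = r 0%N.
Proof. by apply/eqP; rewrite -[_ == _]negbK support_gen // ltxx andbF. Qed.

Lemma gen0_moves x : 0 < x < r 0%N -> a 0%N x != x.
Proof. by rewrite support_gen // (sg_l0 a_std). Qed.

(** The supports of the other generators lie to the right of [r 0]. *)
Lemma gen_fix i x : (0 < i < n)%N -> x <= r 0%N -> a i x = x.
Proof.
move=> /andP[i0 i_lt] xr; apply/eqP; rewrite -[_ == _]negbK support_gen //.
apply/negP => /andP[lx _]; have : r 0%N < l i.
  elim: i i0 i_lt {lx} => // -[|i] IHi _ i_lt; first exact: (sg_sep a_std (i := 1%N)).
  apply: (lt_trans (IHi isT (ltnW i_lt))).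
  apply: (lt_trans (sg_lt a_std (ltnW i_lt))).
  exact: (sg_sep a_std (i := i.+2)).
by move=> rl; have := lt_trans rl lx; rewrite ltNge xr.
Qed.

Lemma lattice_thompson z : lattice n a z -> thompson n z.
Proof.
apply: generated_min; first exact: thompson_subgroup.
by move=> _ [i i_lt <-]; exact: (sg_thompson a_std).
Qed.

Lemma lattice_subgroup : is_subgroup (lattice n a).
Proof. exact: generated_subgroup. Qed.

Lemma gen0X_lattice m : lattice n a (a 0%N ^+ m)%g.
Proof.
by apply: (@subgroupX _ (lattice n a)); [exact: lattice_subgroup|apply: generated_incl; exists 0%N].
Qed.

Lemma gen0X_thompson m : thompson n (a 0%N ^+ m)%g.
Proof. exact: lattice_thompson (gen0X_lattice m). Qed.

Lemma gen0X_itv m x : (0 <= (a 0%N ^+ m)%g x <= r 0%N) = (0 <= x <= r 0%N).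
Proof.
have Fm := gen0X_thompson m; have m0 := thompson_0 Fm.
have mr : (a 0%N ^+ m)%g (r 0%N) = r 0%N.
  by elim: m {Fm m0} => [//|m IHm]; rewrite expgS /= gen0_fix_r0.
by rewrite -{1}m0 -{1}mr !(thompson_le Fm).
Qed.

(** The germ of [a 0] at 0 has slope [n], because its logarithm [chi0 n (a 0)]
    is 1. *)
Lemma gen0_linear : exists2 e, 0 < e < r 0%N &
  forall x : R, 0 <= x <= e -> a 0%N x = n%:R * x.
Proof.
have [k ak] := thompson_germ0 (sg_thompson a_std n_gt0).
have k1 : k = 1.
  have := germ0_chi0 n_ge2 ak; rewrite (sg_chi0 a_std) => /esym/eqP.
  by rewrite -[1]/(1%:~R) eqr_int => /eqP.
case: ak => e e0 ae; exists (Num.min e (r 0%N / 2)).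
  rewrite lt_min e0 divr_gt0 ?r0_gt0 //= gt_min; apply/orP; right.
  by have := r0_gt0; lra.
by move=> x; rewrite le_min => /and3P[x0 xe _]; rewrite ae ?x0 // k1 expr1z.
Qed.

(** On [0, r 0], which [a 0] preserves and the other generators fix pointwise,
    [z] acts as the power [i - j] of [a 0]; moving the negative part of the
    exponent to the left avoids integer powers. *)
Lemma lattice_near_gen0 z : lattice n a z -> exists i j, forall x,
  0 <= x <= r 0%N -> ((a 0%N ^+ j) * z)%g x = (a 0%N ^+ i)%g x.
Proof.
apply: (@generated_min _ _ [set z | exists i j, forall x,
  0 <= x <= r 0%N -> ((a 0%N ^+ j) * z)%g x = (a 0%N ^+ i)%g x]).
  split; first by exists 0%N, 0%N.
  - move=> g h [i [j gE]] [i' [j' hE]]; exists (i + i')%N, (j' + j)%N => x xr.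
    have -> : (a 0%N ^+ (j' + j) * (g * h))%g x = h ((a 0%N ^+ j * g)%g ((a 0%N ^+ j')%g x)).
      by rewrite expgnDr.
    rewrite gE ?gen0X_itv //.
    have -> : (a 0%N ^+ i)%g ((a 0%N ^+ j')%g x) = (a 0%N ^+ j')%g ((a 0%N ^+ i)%g x).
      by rewrite -homeoM -expgnDr addnC expgnDr.
    by rewrite -homeoM hE ?gen0X_itv // expgnDr.
  - move=> g [i [j gE]]; exists j, i => x xr.
    by rewrite homeoM -gE // homeoM homeoVK.
move=> _ [i i_lt <-] /=; case: i i_lt => [|i] i_lt.
  by exists 1%N, 0%N => x _.
by exists 0%N, 0%N => x /andP[_ xr] /=; rewrite gen_fix.
Qed.

Lemma chi0_gen0X m : chi0 n (a 0%N ^+ m)%g = m%:R.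
Proof.
elim: m => [|m IHm]; first by rewrite expg0 (germ0_chi0 n_ge2 (germ0_1 _ _)).
rewrite expgSr chi0M ?IHm ?(sg_chi0 a_std) ?natr1 //; first exact: gen0X_thompson.
exact: (sg_thompson a_std n_gt0).
Qed.

Lemma lattice_chi0_ge0 z : lattice n a z -> 0 <= chi0 n z ->
  exists2 m : nat, chi0 n z = m%:R &
    forall x : R, 0 <= x <= r 0%N -> z x = (a 0%N ^+ m)%g x.
Proof.
move=> Zz z0; have [i [j zE]] := lattice_near_gen0 Zz.
have Fz := lattice_thompson Zz.
have chiE : chi0 n z = i%:R - j%:R.
  have Fjz : thompson n (a 0%N ^+ j * z)%g.
    by have [_ M _] := thompson_subgroup R n_ge2; apply: M => //; exact: gen0X_thompson.
  have [k [e e0 jzE]] := thompson_germ0 Fjz.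
  have ik : germ0 n (a 0%N ^+ i)%g k.
    exists (Num.min e (r 0%N)); first by rewrite lt_min e0 r0_gt0.
    move=> x; rewrite le_min => /and3P[x0 xe xr].
    by rewrite -zE ?x0 // jzE ?x0.
  have jk : germ0 n (a 0%N ^+ j * z)%g k by exists e.
  rewrite -!chi0_gen0X (germ0_chi0 n_ge2 ik) -(germ0_chi0 n_ge2 jk) chi0M //.
    by rewrite addrC addKr.
  exact: gen0X_thompson.
have ji : (j <= i)%N by rewrite -(ler_nat R); lra.
exists (i - j)%N; first by rewrite natrB.
move=> x xr; have := zE ((a 0%N ^+ j)^-1%g x).
rewrite -(gen0X_itv j) homeoKV => /(_ xr).
rewrite homeoM homeoKV => ->.
by rewrite -{1}(subnKC ji) expgnDr homeoM homeoKV.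
Qed.

Lemma gen0X_linear e m x : (forall x : R, 0 <= x <= e -> a 0%N x = n%:R * x) ->
  0 <= x -> n%:R ^+ m * x <= e -> (a 0%N ^+ m)%g x = n%:R ^+ m * x.
Proof.
move=> ae x0; have n1 : 1 <= n%:R :> R by have := base_ge2 R n_ge2; lra.
elim: m => [|m IHm] mx; first by rewrite expg0 expr0 mul1r.
have mx' : n%:R ^+ m * x <= e.
  apply: le_trans mx; rewrite ler_wpM2r // exprS ler_peMl //.
rewrite expgSr homeoM IHm // ae ?mx' ?exprS ?mulrA //.
by rewrite andbT mulr_ge0 // ltW // baseX_gt0.
Qed.

(** The orbit of a small positive point increases to a fixed point of [a 0],
    and the only one in ]0, r 0] is [r 0]. *)
Lemma gen0X_unbounded e x t : (forall x : R, 0 <= x <= e -> a 0%N x = n%:R * x) ->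
  0 < x <= e -> e < r 0%N -> t < r 0%N ->
  exists K, forall k, (K <= k)%N -> t < (a 0%N ^+ k)%g x.
Proof.
move=> ae /andP[x0 xe] er tr; pose u k := (a 0%N ^+ k)%g x.
have n1 : 1 <= n%:R :> R by have := base_ge2 R n_ge2; lra.
have uS k : u k.+1 = a 0%N (u k) by rewrite /u expgSr.
have Fa : thompson n (a 0%N) by exact: (sg_thompson a_std n_gt0).
have u_incr k : u k <= u k.+1.
  elim: k => [|k IHk]; last by rewrite !uS (thompson_le Fa) -uS.
  by rewrite uS /u expg0 /= ae ?(ltW x0) // ler_peMl // ltW.
have u_mono k k' : (k <= k')%N -> u k <= u k'.
  by apply: (@homo_leq _ u <=%R) => //; exact: le_trans.
have u_ub k : u k <= r 0%N.
  have := gen0X_itv k x; rewrite (ltW x0) (le_trans xe (ltW er)).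
  by move=> /andP[].
have uE : has_sup (range u).
  by split; [exists (u 0%N), 0%N|exists (r 0%N) => _ [k _ <-]].
set L := sup (range u).
have uL k : u k <= L by apply: ub_le_sup; [case: uE|exists k].
have Lr : L <= r 0%N by apply: ge_sup; [case: uE|move=> _ [k _ <-]].
have aLL : a 0%N L = L.
  apply/eqP; rewrite eq_le; apply/andP; split; last first.
    apply: ge_sup; first by case: uE.
    by move=> _ [k _ <-]; apply: le_trans (u_incr k) _; rewrite uS (thompson_le Fa).
  rewrite leNgt; apply/negP => La.
  have LaL : 0 < L - (a 0%N)^-1%g L.
    by rewrite subr_gt0 -(thompson_lt Fa) homeoKV.
  have [_ [k _ <-]] := sup_adherent LaL uE; rewrite -/L subKr => kL.
  have := uL k.+1; rewrite uS leNgt => /negP; apply.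
  by rewrite -[X in X < _](homeoKV (a 0%N)) (thompson_lt Fa).
have L0 : 0 < L by apply: lt_le_trans (uL 0%N); rewrite /u expg0.
have LE : L = r 0%N.
  apply/eqP; rewrite eq_le Lr leNgt; apply/negP => Lr'.
  by have := @gen0_moves L; rewrite L0 Lr' aLL eqxx => /(_ isT).
have tL : 0 < L - t by rewrite LE subr_gt0.
have [_ [K _ <-]] := sup_adherent tL uE; rewrite -/L subKr => tK.
by exists K => k Kk; apply: lt_le_trans tK (u_mono _ _ Kk).
Qed.

End Lattice.

(** * Bumps *)

Section IncreasingHomeo.
Variable R : realType.
Implicit Types (f g : R -> R) (h k : homeo R).

Lemma increasing_bij_continuous f g :
  {homo f : x y / x < y} -> cancel g f -> continuous f.
Proof.
move=> f_lt gK x; apply/cvgrPdist_lt => e e0.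
have f_le := leW_mono (le_mono f_lt).
have xl : g (f x - e) < x by rewrite -f_le gK; lra.
have xr : x < g (f x + e) by rewrite -f_le gK; lra.
near=> y; have yl : g (f x - e) < y by near: y; exact: lt_nbhsr.
have yr : y < g (f x + e) by near: y; exact: lt_nbhsl.
move: yl yr; rewrite -f_le gK => yl; rewrite -f_le gK => yr.
by rewrite ltr_norml; apply/andP; split; lra.
Unshelve. all: by end_near. Qed.

Lemma increasing_homeo f g : {homo f : x y / x < y} -> cancel f g ->
  cancel g f -> exists h, h =1 f.
Proof.
move=> f_lt fK gK.
have g_lt : {homo g : x y / x < y}.
  by move=> x y xy; rewrite -(leW_mono (le_mono f_lt)) !gK.
by exists (Homeo fK gK (increasing_bij_continuous f_lt gK)
  (increasing_bij_continuous g_lt fK)).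
Qed.

(** The inverse of a maximum of increasing bijections is the minimum of the
    inverses; with the dual lemma below, this gives piecewise affine
    homeomorphisms without computing their inverses piece by piece. *)
Lemma increasing_homeo_max h k :
  {homo h : x y / x < y} -> {homo k : x y / x < y} ->
  exists2 b : homeo R, {homo b : x y / x < y} &
    forall x, b x = Num.max (h x) (k x).
Proof.
move=> h_lt k_lt; have h_le := le_mono h_lt; have k_le := le_mono k_lt.
pose f x := Num.max (h x) (k x).
have f_lt : {homo f : x y / x < y}.
  by move=> x y xy; rewrite /f gt_max !lt_max h_lt // k_lt // orbT.
pose g y := Num.min (h^-1%g y) (k^-1%g y).
have [] := @increasing_homeo f g f_lt.
- move=> x; rewrite /f /g; case: (leP (h x) (k x)) => hk.
    by rewrite homeoVK min_r // -h_le homeoKV.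
  by rewrite homeoVK min_l // -k_le homeoKV ltW.
- move=> y; rewrite /f /g; case: (leP (h^-1%g y) (k^-1%g y)) => hk.
    by rewrite homeoKV max_l // -[leRHS](homeoKV k) k_le.
  by rewrite homeoKV max_r // -[leRHS](homeoKV h) h_le ltW.
by move=> b bE; exists b => // x y xy; rewrite !bE; exact: f_lt.
Qed.

Lemma increasing_homeo_min h k :
  {homo h : x y / x < y} -> {homo k : x y / x < y} ->
  exists2 b : homeo R, {homo b : x y / x < y} &
    forall x, b x = Num.min (h x) (k x).
Proof.
move=> h_lt k_lt; have h_le := le_mono h_lt; have k_le := le_mono k_lt.
have hV_lt : {homo h^-1%g : x y / x < y}.
  by move=> x y xy; rewrite -(leW_mono h_le) !homeoKV.
have kV_lt : {homo k^-1%g : x y / x < y}.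
  by move=> x y xy; rewrite -(leW_mono k_le) !homeoKV.
have [b b_lt bE] := increasing_homeo_max hV_lt kV_lt.
have b_le := le_mono b_lt.
exists b^-1%g => [x y xy|x]; first by rewrite -(leW_mono b_le) !homeoKV.
apply: (@homeo_inj _ b); rewrite homeoKV bE.
case: (leP (h x) (k x)) => hk; rewrite homeoVK.
  by rewrite max_l // -k_le homeoKV.
by rewrite max_r // -h_le homeoKV ltW.
Qed.

Lemma affine_homeo (s b : R) : 0 < s -> exists2 h : homeo R,
  {homo h : x y / x < y} & forall x, h x = s * x + b.
Proof.
move=> s0; have s_neq0 : s != 0 by rewrite gt_eqF.
have f_lt : {homo (fun x => s * x + b) : x y / x < y}.
  by move=> x y xy; rewrite ltrD2r ltr_pM2l.
have [] := @increasing_homeo _ (fun y => (y - b) / s) f_lt.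
- by move=> x; field.
- by move=> x; field.
by move=> h hE; exists h => // x y xy; rewrite !hE; exact: f_lt.
Qed.

End IncreasingHomeo.

Section Bump.
Variables (R : realType) (n : nat).
Hypothesis n_ge2 : (2 <= n)%N.

(** The bump on [c, c + (n + 1) d] has slope [n] on the first subinterval, of
    length [d], and slope [1 / n] on the second, of length [n d]: these lengths
    make the two pieces meet at height [n d] and return to the diagonal. *)
Lemma bump_exists (c d : R) : nadic n c -> nadic n d -> 0 < c -> 0 < d ->
  c + (n%:R + 1) * d < 1 ->
  exists2 b : homeo R, thompson n b &
    [/\ forall x, x <= c \/ c + (n%:R + 1) * d <= x -> b x = x,
        forall x, c < x < c + (n%:R + 1) * d -> x < b x,
        forall x, `|b x - x| <= (n%:R - 1) * d
      & b (c + d) = c + n%:R * d].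
Proof.
move=> c_nadic d_nadic c0 d0 cd1; set N : R := n%:R in cd1 *.
have N2 : 2 <= N by exact: base_ge2.
have N0 : 0 < N by lra.
have N_neq0 : N != 0 by rewrite gt_eqF.
pose M := N^-1; have NM : N * M = 1 by rewrite /M divff.
have M0 : 0 < M by rewrite invr_gt0; lra.
have M1 : M <= 2^-1 by rewrite /M lef_pV2 ?posrE //; lra.
have [f f_lt fE] := @affine_homeo _ N (c - N * c) N0.
have [g g_lt gE] := @affine_homeo _ M (c - M * c + d * (N - M)) M0.
have [m m_lt mE] := increasing_homeo_min f_lt g_lt.
have [b b_lt bE'] := @increasing_homeo_max _ 1%g m (fun _ _ => id) m_lt.
have {f f_lt fE g g_lt gE m m_lt mE bE'} bE x : b x =
    Num.max x (Num.min (c + N * (x - c)) (c + M * (x - c) + d * (N - M))).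
  rewrite bE' mE fE gE /=; congr (Num.max _ (Num.min _ _)); ring.
(* The gap between the graph of slope M and the diagonal. *)
have gapE x : c + M * (x - c) + d * (N - M) - x =
    (1 - M) * ((N + 1) * d - (x - c)) by ring: NM.
have E1 x : x <= c -> b x = x.
  move=> xc; rewrite bE max_l // ge_min; apply/orP; left.
  nra.
have E2 x : c <= x <= c + d -> b x = c + N * (x - c).
  move=> /andP[cx xd]; rewrite bE min_l; first by rewrite max_r //; nra.
  have : 0 <= (N - M) * (d - (x - c)) by apply: mulr_ge0; lra.
  lra.
have E3 x : c + d <= x <= c + (N + 1) * d ->
    b x = c + M * (x - c) + d * (N - M).
  move=> /andP[dx xd].
  have h1 : 0 <= (N - M) * ((x - c) - d) by apply: mulr_ge0; lra.
  have h2 : 0 <= (1 - M) * ((N + 1) * d - (x - c)) by apply: mulr_ge0; lra.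
  by rewrite bE min_r; [rewrite max_r // -subr_ge0 gapE|lra].
have E4 x : c + (N + 1) * d <= x -> b x = x.
  move=> xd; rewrite bE max_l // ge_min; apply/orP; right.
  rewrite -subr_le0 gapE mulr_ge0_le0 //; lra.
have dN : 0 < N * d by apply: mulr_gt0; lra.
exists b; last split.
- split.
  + move=> x; rewrite in_itv /= negb_and -!ltNge => /orP[x0|x1].
      by apply: E1; lra.
    by apply: E4; lra.
  + exact: b_lt.
  + exists [:: c; c + d; c + (N + 1) * d; 1]; split => //=.
    * by rewrite c0 cd1 /= !andbT; apply/andP; split; lra.
    * have N_nadic : nadic n (N + 1).
        by apply: nadicD => //; [exact: (@nadic_expz R n 1)|exact: (@nadic_int R n 1)].
      move=> x; rewrite !inE => /or4P[] /eqP -> //.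
      - exact: nadicD.
      - by apply: nadicD => //; exact: nadicM.
      - exact: (@nadic_int R n 1).
    * case=> [|[|[|[|//]]]] _ /=; [exists 0|exists 1|exists (-1)|exists 0];
        move=> x; rewrite in_itv /= => /andP[x1 x2].
      - by rewrite !E1 ?expr0z //; [ring|lra].
      - by rewrite !E2 ?expr1z ?x1 ?x2 //; [ring|lra].
      - rewrite !E3 ?x1 ?x2 //; last by apply/andP; split; lra.
        by rewrite -[n%:R ^ -1]/M; ring.
      - by rewrite !E4 ?expr0z //; ring.
- by move=> x [/E1|/E4].
- move=> x /andP[cx xd]; case: (leP x (c + d)) => xcd.
    have h : 0 < (N - 1) * (x - c) by apply: mulr_gt0; lra.
    by rewrite E2 ?xcd ?(ltW cx) //; lra.
  rewrite E3 ?(ltW xcd) ?(ltW xd) // -subr_gt0 gapE.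
  by apply: mulr_gt0; lra.
- move=> x; have Nd : 0 <= (N - 1) * d by apply: mulr_ge0; lra.
  case: (leP x c) => xc; first by rewrite E1 // subrr normr0.
  case: (leP (c + (N + 1) * d) x) => xd; first by rewrite E4 // subrr normr0.
  case: (leP x (c + d)) => xcd.
    have -> : b x - x = (N - 1) * (x - c) by rewrite E2 ?(ltW xc) //; ring.
    rewrite ger0_norm ?ler_pM2l; [lra|lra|apply: mulr_ge0; lra].
  rewrite E3 ?(ltW xcd) ?(ltW xd) // gapE ger0_norm; last by apply: mulr_ge0; lra.
  have -> : (N - 1) * d = (1 - M) * (N * d) by ring: NM.
  by rewrite ler_pM2l; lra.
- by rewrite E2; [ring|apply/andP; split; lra].
Qed.

End Bump.

(** * Sets of elements pinned near 0 *)

Section Slack.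
Variable R : realType.
Implicit Types (x y p q : R).

(** The displacement allowed at [x] by a mark at [p]: of order [x ^+ 2] when
    [x] is far from [p] at its own scale, but only [x ^+ 3] at [x = p]. *)
Definition slack x p : R := x * (x ^+ 2 + `|x - p|).

Lemma slack_ge x p : 0 <= x -> x ^+ 3 <= slack x p.
Proof. by move=> x0; rewrite exprS ler_wpM2l // lerDl. Qed.

Lemma slack_ge0 x p : 0 <= x -> 0 <= slack x p.
Proof. by move=> x0; apply: le_trans (slack_ge p x0); exact: exprn_ge0. Qed.

(** A displacement rescaled by [q] grows by the factor [q], while the slack
    grows at least by [q ^+ 2]: rescaling towards larger points makes the bound
    easier to satisfy, with a gain of [q]. *)
Lemma slack_scale q y p : 1 <= q -> 0 <= y ->
  q ^+ 2 * slack y p <= slack (q * y) (q * p).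
Proof.
move=> q1 y0; rewrite /slack -mulrBr normrM (ger0_norm (le_trans ler01 q1)).
have h : 0 <= q ^+ 2 * y ^+ 3 * (q - 1).
  by rewrite !mulr_ge0 ?exprn_ge0 ?subr_ge0 // (le_trans ler01 q1).
by rewrite -subr_ge0 [leRHS](_ : _ = q ^+ 2 * y ^+ 3 * (q - 1)) //; ring.
Qed.

Lemma slack_le x p : 0 <= x <= 2^-1 -> 0 <= p <= 1 -> slack x p <= x.
Proof.
move=> /andP[x0 x1] /andP[p0 p1]; rewrite ler_piMr //.
have xx : x ^+ 2 <= x * 2^-1 by rewrite expr2 ler_wpM2l.
have : `|x - p| <= 1 - x * 2^-1 by rewrite ler_norml; apply/andP; split; lra.
lra.
Qed.

(** Moving [x] by no more than the slack changes the slack by a bounded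
    factor, so the displacements of a product can be compared with the slack at
    the initial point. *)
Lemma slack_lipschitz x y p : 0 <= x <= 4^-1 -> 0 <= y <= 4^-1 -> 0 <= p <= 1 ->
  slack y p <= slack x p + 2 * `|y - x|.
Proof.
move=> /andP[x0 x1] /andP[y0 y1] /andP[p0 p1]; rewrite /slack !mulrDr -!exprS.
have cube : y ^+ 3 <= x ^+ 3 + 3 / 16 * `|y - x|.
  have -> : y ^+ 3 = x ^+ 3 + (y - x) * (y ^+ 2 + y * x + x ^+ 2) by ring.
  rewrite lerD2l; apply: le_trans (ler_norm _) _; rewrite normrM mulrC.
  rewrite ler_wpM2r // ger0_norm ?addr_ge0 ?mulr_ge0 ?exprn_ge0 //.
  have yy : y ^+ 2 <= 4^-1 * 4^-1 by rewrite expr2 ler_pM.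
  have yx : y * x <= 4^-1 * 4^-1 by rewrite ler_pM.
  have xx : x ^+ 2 <= 4^-1 * 4^-1 by rewrite expr2 ler_pM.
  lra.
have yp1 : `|y - p| <= 1 by rewrite ler_norml; apply/andP; split; lra.
have ypx : `|y - p| <= `|x - p| + `|y - x|.
  by rewrite -[y - p](addrNK (y - x)) addrC; apply: le_trans (ler_normD _ _) _;
    rewrite [leRHS]addrC lerD2l (_ : y - p - (y - x) = x - p) //; ring.
have h1 : x * `|y - p| <= x * `|x - p| + 4^-1 * `|y - x|.
  apply: le_trans (ler_wpM2l x0 ypx) _; rewrite mulrDr lerD2l.
  by rewrite ler_wpM2r.
have h2 : (y - x) * `|y - p| <= `|y - x|.
  apply: le_trans (ler_norm _) _; rewrite normrM normr_id.
  by rewrite ler_piMr.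
have -> : y * `|y - p| = x * `|y - p| + (y - x) * `|y - p| by ring.
have : 0 <= `|y - x| by [].
lra.
Qed.

End Slack.

Section Pinned.
Variable R : realType.
Implicit Types (t x y : R) (P : set R) (g h k z : homeo R).

Definition near_id t P h : Prop := forall x p : R,
  0 <= x <= t -> P p -> `|h x - x| <= slack x p.

(** The condition on the inverse is required separately because the slack is
    evaluated at the initial point, so that the condition on [h] alone is not
    symmetric. *)
Definition pinned n t P : set (homeo R) :=
  [set h | [/\ thompson' n h, near_id t P h & near_id t P h^-1%g]].

Lemma pinned_sub n t P P' : P `<=` P' -> pinned n t P' `<=` pinned n t P.
Proof.
by move=> PP' h [Nh h1 h2]; split=> // x p x0 /PP'; [exact: h1|exact: h2].
Qed.

Lemma near_id_bounds t P h y : t <= 4^-1 -> P 0 -> near_id t P h ->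
  0 <= y <= t -> 0 <= h y <= 2 * y.
Proof.
move=> t1 P0 hP /andP[y0 yt]; have := hP y 0; rewrite y0 yt => /(_ isT P0).
have := @slack_le _ y 0; rewrite y0 lexx ler01 /= => s1 s2.
have {}s1 : slack y 0 <= y by apply: s1 => //; lra.
have := le_trans s2 s1; rewrite ler_norml => /andP[? ?].
by apply/andP; split; lra.
Qed.

Variables (n : nat) (a : nat -> homeo R) (l r : nat -> R) (e t : R) (P : set R).
Hypotheses (n_ge2 : (2 <= n)%N) (a_std : standard_generators n a l r).
Hypotheses (e_lt : e < r 0%N)
  (a0_linear : forall x : R, 0 <= x <= e -> a 0%N x = n%:R * x).
Hypotheses (t_gt0 : 0 < t) (t_le : t <= 4^-1) (te : 4 * t <= e).
Hypotheses (P01 : forall p, P p -> 0 <= p <= 1) (P0 : P 0)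
  (P_scale : forall p, P p -> P (p / n%:R)).

Let t_bounds : [/\ 0 < t, t <= 4^-1 & 4 * t <= e]. Proof. by []. Qed.
Local Notation N := (n%:R : R).
Let n2 : 2 <= N. Proof. exact: base_ge2. Qed.
Let nX_gt0 m : 0 < n%:R ^+ m :> R. Proof. exact: baseX_gt0. Qed.
Let nX_ge1 m : 1 <= n%:R ^+ m :> R.
Proof. by apply: exprn_ege1; apply: le_trans n2; rewrite ler1n. Qed.

Lemma P_scaleX m p : P p -> P (p / n%:R ^+ m).
Proof.
elim: m => [|m IHm] Pp; first by rewrite expr0 divr1.
by rewrite exprSr invfM mulrA; apply/P_scale/IHm.
Qed.

(** Near 0, [z] acts as multiplication by [n ^+ m]. The bound [h y <= 4 * y]
    keeps the image of [y] in the interval where this is so; the factor 4 leaves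
    room for products of two elements that at most double the points. *)
Lemma conj_scaling h z m y :
  (forall x : R, 0 <= x <= r 0%N -> z x = (a 0%N ^+ m)%g x) ->
  0 <= y -> n%:R ^+ m * y <= t -> 0 <= h y <= 4 * y ->
  (h ^ z)%g (n%:R ^+ m * y) = n%:R ^+ m * h y.
Proof.
have [t0 t1 t4] := t_bounds; have n2' := n2.
move=> zE y0 myt /andP[hy0 hy4].
have zX (x : R) : 0 <= x -> n%:R ^+ m * x <= e -> z x = n%:R ^+ m * x.
  move=> x0 xe; rewrite zE; first exact: (gen0X_linear n_ge2 a0_linear).
  by rewrite x0; apply: le_trans (ltW e_lt); apply: le_trans xe; rewrite ler_peMl.
rewrite -zX //; last by apply: le_trans myt _; lra.
rewrite homeoJ zX //; apply: le_trans te.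
apply: (@le_trans _ _ (4 * (n%:R ^+ m * y))); last by rewrite ler_pM2l.
by rewrite mulrCA ler_pM2l.
Qed.

(** The gain of [slack_scale] in usable form: before a conjugation that
    rescales by [n ^+ m], it suffices that the displacement be within [n ^+ m]
    times the slack. *)
Lemma near_id_conj h z m :
  (forall x : R, 0 <= x <= r 0%N -> z x = (a 0%N ^+ m)%g x) ->
  (forall y p : R, 0 <= y -> n%:R ^+ m * y <= t -> P p ->
    0 <= h y <= 4 * y /\ `|h y - y| <= n%:R ^+ m * slack y p) ->
  near_id t P (h ^ z)%g.
Proof.
move=> zE hP x p /andP[x0 xt] Pp.
have xE : x = n%:R ^+ m * (x / n%:R ^+ m) by rewrite mulrC divfK ?gt_eqF.
have pE : p = n%:R ^+ m * (p / n%:R ^+ m) by rewrite mulrC divfK ?gt_eqF.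
have y0 : 0 <= x / n%:R ^+ m by apply: divr_ge0 => //; exact: ltW.
move: xt; rewrite {1}xE => yt.
have [h1 h2] := hP _ _ y0 yt (P_scaleX m Pp).
rewrite xE [in slack _ _]pE (conj_scaling zE) // -mulrBr normrM.
rewrite (ger0_norm (ltW (nX_gt0 m))).
apply: le_trans (slack_scale _ (nX_ge1 m) y0).
by rewrite expr2 -mulrA ler_pM2l.
Qed.

Lemma near_id_conj_pos h z m :
  (forall x : R, 0 <= x <= r 0%N -> z x = (a 0%N ^+ m)%g x) ->
  near_id t P h -> near_id t P (h ^ z)%g.
Proof.
have [t0 t1 t4] := t_bounds; have n2' := n2.
move=> zE hP; apply: near_id_conj zE _ => y p y0 myt Pp.
have yt : 0 <= y <= t by rewrite y0; apply: le_trans myt; rewrite ler_peMl.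
have /andP[hy0 hy2] := near_id_bounds t_le P0 hP yt.
split; first by apply/andP; split; lra.
by apply: le_trans (hP _ _ yt Pp) _; rewrite ler_peMl // slack_ge0.
Qed.

(** A product of two elements moves a point by at most four times the slack:
    once for the first factor and, by the Lipschitz bound, three times for the
    second. Rescaling by [n ^+ 2 >= 4] absorbs this. *)
Lemma near_id_mulX2 g h z m : (2 <= m)%N ->
  (forall x : R, 0 <= x <= r 0%N -> z x = (a 0%N ^+ m)%g x) ->
  near_id t P g -> near_id t P h -> near_id t P ((g * h) ^ z)%g.
Proof.
have [t0 t1 t4] := t_bounds; have n2' := n2.
move=> m2 zE gP hP; apply: near_id_conj zE _ => y p y0 myt Pp.
have m4 : 4 <= n%:R ^+ m :> R.
  rewrite -(subnKC m2) exprD; apply: (@le_trans _ _ (2 ^+ 2 * 1)); first lra.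
  by rewrite ler_pM // ler_pXn2r // nnegrE; lra.
have y4 : 4 * y <= t by apply: le_trans myt; rewrite ler_wpM2r.
have yt : 0 <= y <= t by apply/andP; split; lra.
have /andP[gy0 gy2] := near_id_bounds t_le P0 gP yt.
have gyt : 0 <= g y <= t by apply/andP; split; lra.
have /andP[hgy0 hgy2] := near_id_bounds t_le P0 hP gyt.
rewrite homeoM; split; first by apply/andP; split; lra.
have s1 := gP _ _ yt Pp; have s2 := hP _ _ gyt Pp.
have s3 : slack (g y) p <= slack y p + 2 * `|g y - y|.
  by apply: slack_lipschitz (P01 Pp); apply/andP; split; lra.
have s4 : `|h (g y) - y| <= `|h (g y) - g y| + `|g y - y|.
  by rewrite -[X in `|X| <= _](_ : h (g y) - g y + (g y - y) = _) ?ler_normD //; ring.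
have s5 : 4 * slack y p <= n%:R ^+ m * slack y p.
  by rewrite ler_wpM2r // slack_ge0.
lra.
Qed.

Lemma pinned_confining : confining (thompson' n) (lattice n a) (@chi0 R n)
  (pinned n t P).
Proof.
have [t0 t1 t4] := t_bounds; have n2' := n2.
have sF := thompson_subgroup R n_ge2.
have sN : is_subgroup (thompson' n : set (homeo R)) by exact: generated_subgroup.
have [N1 NM NV] := sN.
have N_conj h z : thompson' n h -> lattice n a z -> thompson' n (h ^ z)%g.
  move=> Nh Zz; apply: derived_conj => //; exact: (lattice_thompson n_ge2 a_std Zz).
have a0XE m x : 0 <= x <= r 0%N -> (a 0%N ^+ m)%g x = (a 0%N ^+ m)%g x by [].
split.
- by move=> h [].
- apply/seteqP; split=> [_ [h [Nh h1 h2] <-]|h [Nh h1 h2]].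
    by split; [exact: NV| |rewrite invgK].
  by exists h^-1%g; rewrite ?invgK //; split; [exact: NV|exact: h2|rewrite invgK].
- move=> z Zz z0 _ [h [Nh h1 h2] <-].
  have [m _ zE] := lattice_chi0_ge0 n_ge2 a_std Zz z0.
  split; [exact: N_conj|exact: near_id_conj_pos zE _|].
  by rewrite -conjVg; exact: near_id_conj_pos zE _.
(* An element of F_n' is the identity near 0, and a large power of [a 0] carries
   the interval where it is so onto one that contains [0,t]. *)
- move=> h Nh; have [f f0 hE] := thompson'_germ0 n_ge2 Nh.
  have {}hE x : 0 <= x <= f -> h x = x by move=> /hE ->; rewrite expr0z mul1r.
  have hVE x : 0 <= x <= f -> h^-1%g x = x.
    by move=> xf; rewrite -{1}(hE x) // homeoVK.
  have [m mf] : exists m, t <= n%:R ^+ m * f.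
    by have [m tm] := baseX_unbounded n_ge2 (t / f); exists m; rewrite -ler_pdivrMr.
  exists (a 0%N ^+ m)%g; first exact: gen0X_lattice.
  have triv_ok k : (forall x : R, 0 <= x <= f -> k x = x) ->
      near_id t P (k ^ (a 0%N ^+ m))%g.
    move=> kE; apply: near_id_conj (a0XE m) _ => y p y0 myt Pp.
    rewrite kE; last by rewrite y0 -(ler_pM2l (nX_gt0 m)) (le_trans myt).
    rewrite subrr normr0; split; first by apply/andP; split; lra.
    by rewrite mulr_ge0 ?slack_ge0 // ltW.
  split; [|exact: triv_ok|by rewrite -conjVg; exact: triv_ok].
  by apply: N_conj => //; exact: gen0X_lattice.
- exists (a 0%N ^+ 2)%g; first exact: gen0X_lattice.
  move=> _ [_ [g [Ng g1 g2] [h [Nh h1 h2] <-]] <-]; split.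
  + by apply: N_conj; [exact: NM|exact: gen0X_lattice].
  + exact: near_id_mulX2 (a0XE 2%N) _ _.
  + by rewrite -conjVg invgM; exact: near_id_mulX2 (a0XE 2%N) _ _.
Qed.

(** A bump [b] need not lie in F_n', but [b] times the conjugate of its inverse
    by [a 0] does, being a commutator. The second factor is the inverse bump at
    the next larger scale: it is supported to the right of [b], and it satisfies
    the same bound on the displacement by [slack_scale]. *)
Lemma pinned_bump (c d : R) : nadic n c -> nadic n d -> 0 < c -> 0 < d ->
  c + (N + 1) * d <= t -> c + (N + 1) * d <= N * c ->
  (forall x p, c <= x <= c + (N + 1) * d -> P p -> (N - 1) * d <= slack x p) ->
  exists2 h : homeo R, pinned n t P h &
    (forall x, c < x < c + (N + 1) * d -> x < h x) /\ h (c + d) = c + N * d.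
Proof.
move=> c_nadic d_nadic c0 d0 ut uc slackP; set u := c + _ in ut uc slackP *.
have [t0 t1 t4] := t_bounds; have n2' := n2.
have cdu : c + d < u by rewrite /u ltrD2l ltr_pMl //; lra.
have u1 : u < 1 by lra.
have [b Fb [b_id b_gt b_near bE]] := bump_exists n_ge2 c_nadic d_nadic c0 d0 u1.
have Fa : thompson n (a 0%N) by exact: (sg_thompson a_std (ltnW n_ge2)).
have bV_id x : x <= c \/ u <= x -> b^-1%g x = x.
  by move=> /b_id xE; rewrite -{1}xE homeoVK.
have b_ok : near_id t P b.
  move=> x p /andP[x0 xt] Pp; case: (leP x c) => xc.
    by rewrite b_id ?subrr ?normr0 ?slack_ge0 //; left.
  case: (leP u x) => xu; first by rewrite b_id ?subrr ?normr0 ?slack_ge0 //; right.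
  by apply: le_trans (b_near x) (slackP _ _ _ Pp); rewrite !ltW.
have bV_ok : near_id t P b^-1%g.
  move=> x p /andP[x0 xt] Pp; case: (leP x c) => xc.
    by rewrite bV_id ?subrr ?normr0 ?slack_ge0 //; left.
  case: (leP u x) => xu; first by rewrite bV_id ?subrr ?normr0 ?slack_ge0 //; right.
  have := b_near (b^-1%g x); rewrite homeoKV distrC => bVx.
  by apply: le_trans bVx (slackP _ _ _ Pp); rewrite !ltW.
have a0E (x : R) : 0 <= x <= r 0%N -> a 0%N x = (a 0%N ^+ 1)%g x by [].
pose k := (b^-1 ^ a 0)%g.
have k_ok : near_id t P k by exact: near_id_conj_pos a0E bV_ok.
have kV_ok : near_id t P k^-1%g.
  by rewrite -conjVg; apply: near_id_conj_pos a0E _; rewrite invgK.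
(* The second copy of the bump is supported in [N c, N u], beyond u. *)
have k_id x : 0 <= x <= u -> k x = x.
  move=> /andP[x0 xu].
  have [y0 yc] : 0 <= x / N /\ x / N <= c.
    by split; [apply: divr_ge0 => //; lra|rewrite ler_pdivrMr; lra].
  have ay : a 0%N (x / N) = x.
    by rewrite a0_linear; [rewrite mulrC divfK // gt_eqF //|]; lra.
  by rewrite -{1}ay homeoJ bV_id ?ay //; left.
have b_u x : x < u -> b x < u.
  by rewrite -{2}(b_id u) ?(thompson_lt Fb) //; right.
have b_ge0 x : 0 <= x -> 0 <= b x by rewrite -{2}(thompson_0 Fb) (thompson_le Fb).
have hE x : 0 <= x < u -> (b * k)%g x = b x.
  by move=> /andP[x0 xu]; rewrite homeoM k_id // b_ge0 //= ltW // b_u.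
exists (b * k)%g; last first.
  split=> [x /andP[cx xu]|]; last by rewrite hE // cdu andbT; lra.
  by rewrite hE ?b_gt ?cx //; apply/andP; split; [lra|].
split.
- rewrite /k -[X in (X * _)%g]invgK; apply: derived_comm => //.
  by have [_ _ FV] := thompson_subgroup R n_ge2; exact: FV.
- move=> x p /andP[x0 xt] Pp; case: (ltP x u) => xu.
    by rewrite hE ?x0 //; apply: b_ok; rewrite ?x0.
  by rewrite homeoM b_id; [apply: k_ok; rewrite ?x0|right].
- move=> x p /andP[x0 xt] Pp; rewrite invgM homeoM.
  case: (leP x u) => xu.
    have -> : k^-1%g x = x by rewrite -{1}(k_id x) ?x0 // homeoVK.
    by apply: bV_ok; rewrite ?x0.
  rewrite bV_id; first by apply: kV_ok; rewrite ?x0.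
  right; rewrite leNgt; apply/negP => ku.
  have Fk : thompson n k.
    have sF := thompson_subgroup R n_ge2; apply: subgroupJ => //.
    by have [_ _ FV] := sF; exact: FV.
  have kV0 : 0 <= k^-1%g x.
    by rewrite -(thompson_le Fk) homeoKV (thompson_0 Fk).
  have := k_id (k^-1%g x); rewrite kV0 (ltW ku) homeoKV => /(_ isT) xE.
  by have := lt_trans ku xu; rewrite -xE ltxx.
Qed.

(** The slack is at least [x ^+ 3] whatever the marks are, so small enough bumps
    around any point are allowed. *)
Lemma pinned_moves (y : R) : 0 < y -> 2 * y <= t ->
  exists2 h : homeo R, pinned n t P h & y < h y.
Proof.
move=> y0 yt; have [t0 t1 t4] := t_bounds; have n2' := n2.
have y3 : 0 < y ^+ 3 by exact: exprn_gt0.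
have [D Dy] := baseX_unbounded n_ge2 (8 * N / y ^+ 3).
pose d := (N ^+ D)^-1; have d0 : 0 < d by rewrite invr_gt0.
have dy : 8 * (N * d) <= y ^+ 3.
  by rewrite mulrA /d ler_pdivrMr // [leRHS]mulrC -ler_pdivrMr.
have d_nadic : nadic n d by exists 1, D; rewrite mul1r.
(* A multiple of [d] between [y - 2 d] and [y - d], so that [y] lies inside
   the support of the bump. *)
pose c := ((Num.floor (y / d))%:~R - 1) * d.
have c_nadic : nadic n c.
  by apply: nadicM => //; rewrite -[1]/(1%:~R) -intrB; exact: nadic_int.
have cy : c + d <= y.
  by rewrite /c mulrBl mul1r subrK -ler_pdivlMr // floor_le.
have yc : y < c + 2 * d.
  have : y < ((Num.floor (y / d))%:~R + 1) * d.
    by rewrite -ltr_pdivrMr // -[1]/(1%:~R) -intrD floorD1_gt.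
  by rewrite /c; lra.
have yy : y ^+ 3 <= y / 16.
  rewrite exprS ler_wpM2l ?(ltW y0) // expr2.
  by apply: le_trans (_ : 4^-1 * 4^-1 <= _); [apply: ler_pM; lra|lra].
have dNd : 2 * d <= N * d by rewrite ler_wpM2r // ltW.
have cN : 2 * c <= N * c by rewrite ler_wpM2r //; lra.
have [h hP [h_gt _]] : exists2 h : homeo R, pinned n t P h &
    (forall x, c < x < c + (N + 1) * d -> x < h x) /\ h (c + d) = c + N * d.
  apply: pinned_bump => //; [lra|lra|lra|].
  move=> x p /andP[cx _] Pp; have x0 : y / 2 <= x by lra.
  have x00 : 0 <= x by lra.
  apply: le_trans (slack_ge p x00).
  have : (y / 2) ^+ 3 <= x ^+ 3 by rewrite lerXn2r ?nnegrE //; lra.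
  have -> : (y / 2) ^+ 3 = y ^+ 3 / 8 by field.
  lra.
by exists h => //; apply: h_gt; apply/andP; split; lra.
Qed.

(** If conjugation by [a 0] mapped the set onto itself, any element [h] of it
    would be a conjugate by [a 0 ^+ k] of an element of the set, for every [k];
    as the slack is quadratic, the displacement of [h] would then be of order
    [n ^- k], hence zero. *)
Lemma pinned_strictly_confining :
  strictly_confining (thompson' n) (lattice n a) (@chi0 R n) (pinned n t P).
Proof.
have [t0 t1 t4] := t_bounds; have n2' := n2.
have cQ := pinned_confining.
split=> //; exists (a 0%N); first exact: (gen0X_lattice n_ge2 1).
split.
  case: cQ => _ _ QJ _ _; apply: QJ; first exact: (gen0X_lattice n_ge2 1).
  by rewrite (sg_chi0 a_std).
move=> QQ; pose y := t / 2.
have y0 : 0 < y by rewrite /y; lra.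
have y2t : 2 * y <= t by rewrite /y; lra.
have [h hQ hy] := pinned_moves y0 y2t.
have rootQ (k : nat) : exists2 q, pinned n t P q & h = (q ^ (a 0 ^+ k))%g.
  elim: k => [|k [_ /QQ[q qQ <-] ->]]; first by exists h; rewrite // expg0 conjg1.
  by exists q => //; rewrite -conjgM expgS.
have [k kP] := baseX_unbounded n_ge2 ((h y - y)^-1).
have [q [_ qP _] hE] := rootQ k.
pose x := y / N ^+ k; have xE : N ^+ k * x = y by rewrite mulrC divfK // gt_eqF.
have x0 : 0 < x by exact: divr_gt0.
have xy : x <= y by rewrite -xE ler_peMl // ltW.
have xt : 0 <= x <= t by rewrite ltW //=; apply: le_trans xy _; rewrite /y; lra.
have /andP[qx0 qx2] := near_id_bounds t_le P0 qP xt.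
have hy' : h y = N ^+ k * q x.
  rewrite hE -{1}xE conj_scaling ?(ltW x0) //.
    by rewrite xE /y; lra.
  by apply/andP; split; lra.
have := qP x 0 xt P0; rewrite /slack subr0 (ger0_norm (ltW x0)) => qx.
have xx : x * (x ^+ 2 + x) <= 2 * x ^+ 2.
  have -> : x * (x ^+ 2 + x) = x ^+ 2 * (x + 1) by ring.
  by rewrite mulrC ler_wpM2r ?exprn_ge0 ?(ltW x0) //; rewrite /y in xy; lra.
have qxx : q x - x <= 2 * x ^+ 2 by apply: le_trans xx; apply: le_trans qx; exact: ler_norm.
have hyk : (h y - y) * N ^+ k <= 2 * y ^+ 2.
  have -> : (h y - y) * N ^+ k = N ^+ k ^+ 2 * (q x - x) by rewrite hy' -xE; ring.
  have -> : 2 * y ^+ 2 = N ^+ k ^+ 2 * (2 * x ^+ 2) by rewrite -xE; ring.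
  by rewrite ler_wpM2l // exprn_ge0 // ltW.
have : 1 <= (h y - y) * N ^+ k.
  by rewrite -ler_pdivrMl ?subr_gt0 // mulr1.
have : y ^+ 2 <= 8^-1 * 8^-1.
  by rewrite expr2 ler_pM ?(ltW y0) // /y; lra.
lra.
Qed.

End Pinned.

(** * The marks attached to a set of integers *)

Section Marks.
Variables (R : realType) (n : nat).
Hypothesis n_ge2 : (2 <= n)%N.
Implicit Types (A B : set nat) (i j : nat).
Local Notation N := (n%:R : R).

(** In the scale [n ^- i], each [j] has its own mark; as [1 - n ^- (j + 2)] lies
    in [3/4, 1[, no power of [n] identifies the marks of distinct integers. *)
Definition mark i j : R := (1 - (N ^+ j.+2)^-1) / N ^+ i.

(** The mark 0 bounds the displacement by a quadratic function even if [A] is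
    empty. *)
Definition marks A : set R :=
  [set p | p = 0 \/ exists i j, A j /\ p = mark i j].

Let n2 : 2 <= N. Proof. exact: base_ge2. Qed.
Let nX_gt0 m : 0 < N ^+ m. Proof. exact: baseX_gt0. Qed.
Let nX_ge1 m : 1 <= N ^+ m.
Proof. by apply: exprn_ege1; apply: le_trans n2; rewrite ler1n. Qed.

Lemma baseXV_le i : (N ^+ i)^-1 <= (2 ^+ i)^-1.
Proof. by rewrite lef_pV2 ?posrE ?nX_gt0 ?exprn_gt0 // lerXn2r ?nnegrE ?ler0n. Qed.

Lemma baseXV_le8 k : (N ^+ k.+3)^-1 <= 8^-1.
Proof.
apply: le_trans (baseXV_le _) _; rewrite lef_pV2 ?posrE ?exprn_gt0 //.
by rewrite -natrX ler_nat (@leq_exp2l 2 3).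
Qed.

Lemma mark_bounds i j : 3 / 4 / N ^+ i <= mark i j <= (N ^+ i)^-1.
Proof.
have := baseXV_le j.+2; have := nX_gt0 j.+2; rewrite -invr_gt0.
rewrite /mark; set f := (N ^+ j.+2)^-1 => f0 f1.
have f2 : f <= 4^-1.
  apply: le_trans f1 _; rewrite lef_pV2 ?posrE ?exprn_gt0 //.
  by rewrite -natrX ler_nat; rewrite (@leq_exp2l 2 2).
have e0 : 0 < (N ^+ i)^-1 by rewrite invr_gt0.
apply/andP; split; first by rewrite ler_pM2r //; lra.
by rewrite -[leRHS]mul1r ler_pM2r //; lra.
Qed.

Lemma marks01 A p : marks A p -> 0 <= p <= 1.
Proof.
case=> [->|[i [j [_ ->]]]]; first by rewrite lexx ler01.
have /andP[m1 m2] := mark_bounds i j; apply/andP; split.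
  by apply: le_trans m1; rewrite divr_ge0 ?(ltW (nX_gt0 _)) //; lra.
by apply: le_trans m2 _; rewrite invf_le1.
Qed.

Lemma marks_scale A p : marks A p -> marks A (p / N).
Proof.
case=> [->|[i [j [Aj ->]]]]; first by left; rewrite mul0r.
by right; exists i.+1, j; split => //; rewrite /mark -mulrA -invfM -exprSr.
Qed.

Lemma marks_sub A B : A `<=` B -> marks A `<=` marks B.
Proof.
by move=> AB p [->|[i [j [/AB Bj ->]]]]; [left|right; exists i, j].
Qed.

(** The separation is proportional to the scale [n ^- i], so that around a mark
    of [j] the slack for the marks of [B] is quadratic. In distinct scales the
    marks differ by at least a factor 3/2; in a common scale the difference is
    that of two distinct powers [n ^- (j + 2)] and [n ^- (j' + 2)], at least
    half of the larger one and thus at least [n ^- (j + 3)]. *)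
Lemma marks_separated B i j p : ~ B j -> marks B p ->
  (N ^+ i)^-1 * (N ^+ j.+3)^-1 <= `|mark i j - p|.
Proof.
move=> nBj; have n2' := n2.
have ei : 0 < (N ^+ i)^-1 by rewrite invr_gt0.
have fj : 0 < (N ^+ j.+3)^-1 by rewrite invr_gt0.
have fj8 : (N ^+ j.+3)^-1 <= 8^-1 by exact: baseXV_le8.
have efj : (N ^+ i)^-1 * (N ^+ j.+3)^-1 <= (N ^+ i)^-1 * 8^-1 by rewrite ler_pM2l.
have /andP[m1 m2] := mark_bounds i j.
have NE k : N * (N ^+ k.+1)^-1 = (N ^+ k)^-1.
  by rewrite exprS invfM mulVKf // gt_eqF //; lra.
case=> [->|[i' [j' [Bj' ->]]]].
  by rewrite subr0; apply: le_trans (ler_norm _); lra.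
have jj' : j != j' by apply: contra_not_neq nBj => ->.
have /andP[m1' m2'] := mark_bounds i' j'.
have decay k k' : (k < k')%N -> (N ^+ k')^-1 <= 2^-1 * (N ^+ k)^-1.
  move=> kk'; rewrite -invfM lef_pV2 ?posrE //; last exact: mulr_gt0.
  rewrite -(subnKC kk') exprD exprS -mulrA.
  apply: (@le_trans _ _ (N * N ^+ k)); first by rewrite ler_pM2r.
  by rewrite ler_pM2l ?ler_peMr // ?ltW //; lra.
case: (ltngtP i i') => ii'.
- have := decay _ _ ii' => d; apply: le_trans (ler_norm _); lra.
- have := decay _ _ ii' => d; rewrite distrC; apply: le_trans (ler_norm _); lra.
rewrite -ii' /mark -mulrBl normrM (gtr0_norm ei) mulrC ler_pM2r //.
have -> : 1 - (N ^+ j.+2)^-1 - (1 - (N ^+ j'.+2)^-1) =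
  (N ^+ j'.+2)^-1 - (N ^+ j.+2)^-1 by ring.
have := NE j.+2 => NEj.
have f0 : 2 * (N ^+ j.+3)^-1 <= N * (N ^+ j.+3)^-1 by rewrite ler_pM2r.
case: (ltngtP j j') jj' => // jj' _.
  have := decay j.+2 j'.+2 jj' => d.
  by rewrite distrC; apply: le_trans (ler_norm _); lra.
have := decay j'.+2 j.+2 jj' => d.
by apply: le_trans (ler_norm _); lra.
Qed.

End Marks.

(** * Comparison of the pinned sets *)

Lemma depth_exists K T j : exists i,
  [/\ K <= i, T <= i, T <= i - K & K * 2 + (i * 2 + j.+3 + 3).+1 < i * 3]%N.
Proof. by exists (2 * K + j + 8 + T)%N; split; lia. Qed.

Section Structures.
Variables (R : realType) (n : nat) (a : nat -> homeo R) (l r : nat -> R) (e t : R).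
Hypotheses (n_ge2 : (2 <= n)%N) (a_std : standard_generators n a l r).
Hypotheses (e_lt : e < r 0%N)
  (a0_linear : forall x : R, 0 <= x <= e -> a 0%N x = n%:R * x).
Hypotheses (t_gt0 : 0 < t) (t_le : t <= 4^-1) (te : 4 * t <= e).

Local Notation N := (n%:R : R).
Let t_bounds : [/\ 0 < t, t <= 4^-1 & 4 * t <= e]. Proof. by []. Qed.
Let n2 : 2 <= N. Proof. exact: base_ge2. Qed.
Let nX_gt0 m : 0 < N ^+ m. Proof. exact: baseX_gt0. Qed.

(** The bump is placed so that the mark is the point [c + d] where its
    displacement is largest. Its size [n ^- (2 i + j + 7)] is quadratic in the
    scale [n ^- i] of the mark, within the slack given by [marks_separated]. *)
Lemma mark_displaced B i j : ~ B j -> 2 * (N ^+ i)^-1 <= t ->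
  exists2 h : homeo R, pinned n t (marks n B) h &
    (N ^+ (i * 2 + j.+3 + 3).+1)^-1 <= h (mark R n i j) - mark R n i j.
Proof.
move=> nBj it; have [t0 t1 t4] := t_bounds; have n2' := n2.
(* The exponent makes [n d] equal to [E ^+ 2 * F * G], where [E * F] is the
   separation of the marks and [G <= 1 / 8] leaves room for the extent of the
   bump. *)
set y := mark R n i j; set d := (N ^+ (i * 2 + j.+3 + 3).+1)^-1.
set E := (N ^+ i)^-1 in it *; pose F := (N ^+ j.+3)^-1; pose G := (N ^+ 3)^-1.
have E0 : 0 < E by rewrite invr_gt0.
have F0 : 0 < F by rewrite invr_gt0.
have G0 : 0 < G by rewrite invr_gt0.
have /andP[yE1 yE2] : 3 / 4 * E <= y <= E by exact: mark_bounds.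
have d0 : 0 < d by rewrite invr_gt0.
have NdE : N * d = E ^+ 2 * F * G.
  rewrite /E /F /G exprVn -exprM -!invfM -!exprD /d.
  by rewrite exprS invfM mulVKf // gt_eqF //; lra.
have F8 : F <= 8^-1 by exact: baseXV_le8.
have G8 : G <= 8^-1 by exact: (baseXV_le8 R n_ge2 0).
have EF0 : 0 < E * F by exact: mulr_gt0.
have EF : E * F <= E / 8 by rewrite ler_pM2l.
have E1 : E <= 1 by lra.
have NdE2 : N * d <= E * (E * F) / 8.
  have -> : N * d = E * (E * F) * G by rewrite NdE; ring.
  by rewrite ler_pM2l ?mulr_gt0.
have EEF : E * (E * F) <= E * F by rewrite ler_piMl // ltW.
have NdEF : N * d <= E * F / 8 by lra.
have dN : 2 * d <= N * d by rewrite ler_pM2r.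
have y0 : 0 < y by lra.
have c_nadic : nadic n (y - d).
  apply: nadicD => //; last by apply: nadicN; exists 1, (i * 2 + j.+3 + 3).+1%N; rewrite mul1r.
  apply: nadicM => //; last by exists 1, i; rewrite mul1r.
  apply: nadicD => //; first exact: (@nadic_int R n 1).
  by apply: nadicN; exists 1, j.+2; rewrite mul1r.
have d_nadic : nadic n d by exists 1, (i * 2 + j.+3 + 3).+1%N; rewrite mul1r.
have cN : 2 * (y - d) <= N * (y - d) by rewrite ler_wpM2r //; lra.
have [||||x p /andP[cx xu] Bp|h hP [_ hE]] := @pinned_bump _ n a l r e t (marks n B)
  n_ge2 a_std e_lt a0_linear t_gt0 t_le te (or_introl erefl)
  (@marks_scale R n B) (y - d) d c_nadic d_nadic.
- lra.
- exact: d0.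
- lra.
- lra.
- have x0 : E / 2 <= x by lra.
  have yp : E * F <= `|y - p| by exact: (marks_separated n_ge2 i nBj Bp).
  have xy : `|y - x| <= N * d by rewrite ler_norml; apply/andP; split; lra.
  have xp : E * F / 2 <= `|x - p|.
    have : `|y - p| <= `|y - x| + `|x - p| by exact: ler_distD.
    lra.
  have h1 : E / 2 * (E * F / 2) <= x * `|x - p| by apply: ler_pM; lra.
  have h2 : 0 <= x ^+ 3 by apply: exprn_ge0; lra.
  by rewrite /slack mulrDr -exprS; lra.
exists h => //; move: hE; rewrite subrK => ->; lra.
Qed.

Let pinned_strict A : strictly_confining (thompson' n) (lattice n a) (@chi0 R n)
  (pinned n t (marks n A)).
Proof.
exact: (pinned_strictly_confining n_ge2 a_std e_lt a0_linear t_gt0 t_le te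
  (@marks01 R n n_ge2 A) (or_introl erefl) (@marks_scale R n A)).
Qed.

(** The factor in [Z] given by [bounded_word_conj] lies in F_n' as well. So its
    germ at 0 is trivial, which makes it the identity on [0, r 0]: it can be
    ignored near 0. *)
Lemma conf_le_conj Q1 Q2 :
  confining (thompson' n) (lattice n a) (@chi0 R n) Q1 ->
  Q2 `<=` thompson' n -> conf_le (lattice n a) (@chi0 R n) Q1 Q2 ->
  exists K, forall k q, (K <= k)%N -> Q2 q ->
    exists2 z : homeo R, forall x : R, 0 <= x <= r 0%N -> z x = x &
      Q1 ((q * z^-1) ^ (a 0 ^+ k))%g.
Proof.
move=> cQ1 Q2N [k kQ].
have sN : is_subgroup (thompson' n : set (homeo R)) by exact: generated_subgroup.
have [N1 NM NV] := sN; have sZ := lattice_subgroup n a; have [_ ZM ZV] := sZ.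
have chiM z w : lattice n a z -> lattice n a w ->
    chi0 n (z * w)%g = chi0 n z + chi0 n w.
  by move=> Zz Zw; apply: chi0M => //; exact: (lattice_thompson n_ge2 a_std).
have [c cP] := bounded_word_conj sZ chiM k N1 cQ1.
exists (Num.bound `|c|) => m q cm Q2q.
have [z Zz zQ] := cP _ (kQ _ Q2q).
have ac : c <= chi0 n (a 0 ^+ m)%g.
  rewrite (chi0_gen0X n_ge2 a_std); apply: le_trans (ler_norm _) _.
  apply: le_trans (ltW (archi_boundP (normr_ge0 c))) _.
  by rewrite ler_nat.
have Q1z := zQ _ (gen0X_lattice n_ge2 m) ac.
exists z => // x xr.
have Nz : thompson' n z.
  have -> : z = ((((q * z^-1) ^ (a 0 ^+ m)) ^ (a 0 ^+ m)^-1)^-1 * q)%g :> homeo R.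
    by rewrite conjgK invgM invgK mulgVK.
  apply: NM; last exact: Q2N.
  apply: NV; apply: derived_conj; first exact: thompson_subgroup.
    have [_ _ FV] := thompson_subgroup R n_ge2.
    exact/FV/(gen0X_thompson n_ge2 a_std).
  by case: cQ1 => Q1N _ _ _ _; exact: Q1N.
have z0 := thompson'_chi0 n_ge2 Nz.
have [|i] := lattice_chi0_ge0 n_ge2 a_std Zz; first by rewrite z0.
rewrite z0 => /esym/eqP; rewrite pnatr_eq0 => /eqP -> ->//.
Qed.

(** If [j] is in [A] but not in [B], an element of the second set moves the mark
    [mark i j] by [n ^- (2 i + j + 7)], whereas membership in the conjugate of
    the first set by a fixed power [K] of [a 0] allows only
    [n ^+ (2 K) * n ^- (3 i)]: this fails when [i] is large. *)
Lemma pinned_marks_le A B :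
  conf_le (lattice n a) (@chi0 R n) (pinned n t (marks n A))
    (pinned n t (marks n B)) -> A `<=` B.
Proof.
move=> leAB j Aj; apply: contrapT => nBj; have [t0 t1 t4] := t_bounds; have er := e_lt.
have [cA _] := pinned_strict A.
have [|K KP] := conf_le_conj cA _ leAB; first by move=> q [].
have [T TP] := baseX_unbounded n_ge2 (2 / t).
have invt m : (T <= m)%N -> 2 * (N ^+ m)^-1 <= t.
  move=> Tm; rewrite ler_pdivrMr // mulrC -ler_pdivrMr //; apply: le_trans TP _.
  by rewrite ler_weXn2l //; have := n2; lra.
have [i [Ki Ti TiK deep]] := depth_exists K T j.
have [q qB qy] : exists2 h : homeo R, pinned n t (marks n B) h &
    (N ^+ (i * 2 + j.+3 + 3).+1)^-1 <= h (mark R n i j) - mark R n i j.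
  by apply: mark_displaced => //; exact: invt.
set y := mark R n i j in qy.
have /andP[y1 y2] := mark_bounds R n_ge2 i j.
have y0 : 0 < y by apply: lt_le_trans y1; rewrite !divr_gt0 ?nX_gt0.
have yt : y <= t.
  apply: le_trans y2 _; have := invt i Ti; have : 0 < (N ^+ i)^-1 by rewrite invr_gt0.
  lra.
have [z z_id zA] := KP K q (leqnn K) qB.
have zV_id x : 0 <= x <= r 0%N -> z^-1%g x = x.
  by move=> xr; rewrite -{1}(z_id x) // homeoVK.
have [_ qP _] := qB.
have /andP[qy0 qy2] : 0 <= q y <= 2 * y.
  by apply: (near_id_bounds t_le _ qP); [left|rewrite ltW].
have qzE : (q * z^-1)%g y = q y by rewrite homeoM zV_id //; apply/andP; split; lra.
have xE : N ^+ K * y = mark R n (i - K) j.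
  rewrite /y /mark mulrC -mulrA; congr (_ * _).
  by rewrite -{1}(subnK Ki) exprD invfM mulfVK // gt_eqF.
have xt : N ^+ K * y <= t.
  rewrite xE; have /andP[_ m2] := mark_bounds R n_ge2 (i - K) j.
  apply: le_trans m2 _; have := invt (i - K)%N TiK.
  have : 0 < (N ^+ (i - K))^-1 by rewrite invr_gt0.
  lra.
have [_ zP _] := zA.
have xA : marks n A (N ^+ K * y) by right; exists (i - K)%N, j.
have x0 : 0 <= N ^+ K * y <= t by rewrite mulr_ge0 ?(ltW (nX_gt0 K)) ?(ltW y0).
have := zP _ _ x0 xA.
rewrite (conj_scaling n_ge2 e_lt a0_linear t_gt0 t_le te) ?(ltW y0) //; last first.
  by rewrite qzE; apply/andP; split; lra.
rewrite qzE /slack subrr normr0 addr0 -exprS -mulrBr normrM (gtr0_norm (nX_gt0 K)).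
rewrite exprMn exprS -!mulrA ler_pM2l // => qy3.
have {}qy3 : q y - y <= N ^+ K ^+ 2 * y ^+ 3.
  by rewrite expr2 -mulrA; apply: le_trans qy3; exact: ler_norm.
have y3 : y ^+ 3 <= (N ^+ i)^-1 ^+ 3.
  by rewrite lerXn2r // nnegrE ?(ltW y0) ?invr_ge0 ?(ltW (nX_gt0 _)).
have : (N ^+ (i * 2 + j.+3 + 3).+1)^-1 <= N ^+ K ^+ 2 * (N ^+ i)^-1 ^+ 3.
  apply: le_trans qy _; apply: le_trans qy3 _.
  by rewrite ler_pM2l // exprn_gt0.
rewrite exprVn -!exprM -[leLHS]mul1r ler_pdivrMr // mulrAC ler_pdivlMr // mul1r -exprD.
rewrite ler_eXn2l; last by have := n2; lra.
by rewrite leqNgt deep.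
Qed.

(** Otherwise all pinned elements would fix the preimage of [s] by each large
    power of [a 0]; these preimages tend to 0, where [pinned_moves] applies. *)
Lemma pinned_not_fixing A Q (s : R) :
  confining (thompson' n) (lattice n a) (@chi0 R n) Q ->
  conf_le (lattice n a) (@chi0 R n) Q (pinned n t (marks n A)) ->
  0 < s < r 0%N -> ~ (forall q : homeo R, Q q -> q s = s).
Proof.
move=> cQ leQ /andP[s0 sr] Qs; have [t0 t1 t4] := t_bounds; have er := e_lt.
have [|K KP] := conf_le_conj cQ _ leQ; first by move=> q [].
have th : 0 < t / 2 <= e by apply/andP; split; lra.
have [M MP] := gen0X_unbounded n_ge2 a_std a0_linear th e_lt sr.
pose k := maxn K M; pose w := (a 0 ^+ k)%g; pose y := w^-1%g s.
have Fw : thompson n w by exact: (gen0X_thompson n_ge2 a_std).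
have y0 : 0 < y by rewrite -(thompson_lt Fw) homeoKV (thompson_0 Fw).
have yt : 2 * y <= t.
  have : y < t / 2 by rewrite -(thompson_lt Fw) homeoKV; apply: MP; exact: leq_maxr.
  lra.
have [q qA yq] := pinned_moves n_ge2 a_std e_lt a0_linear t_gt0 t_le te
  (or_introl erefl) (@marks_scale R n A) y0 yt.
have [z z_id zQ] := KP k q (leq_maxl _ _) qA.
have := Qs _ zQ; rewrite -(homeoKV w s) homeoJ -/y => /(@homeo_inj _ w).
rewrite homeoM => /(congr1 z); rewrite homeoKV z_id; last by apply/andP; split; lra.
by move=> qy; move: yq; rewrite qy ltxx.
Qed.

Lemma pinned_power_set : exists Phi : set nat -> conf_chi0 n a,
  (forall A B : set nat, (Phi A <= Phi B)%O <-> A `<=` B) /\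
  (forall A : set nat, ~ lamplike (r 0%N) (Phi A)).
Proof.
have repP A : pinned n t (marks n A) \in [set` [set Q |
    strictly_confining (thompson' n) (lattice n a) (@chi0 R n) Q]].
  by apply/mem_set/mem_set; exact: pinned_strict.
pose rep A : conf_rep (thompson' n) (lattice n a) (@chi0 R n) := SigSub (repP A).
exists (fun A => conf_class (rep A)); split=> [A B|A [Q /conf_classP[leQ _]]].
  apply: (iff_trans (conf_ord_class _ _)); split; first exact: pinned_marks_le.
  move=> AB; exists 1%N => q qB; exists [:: q]; split=> //; last by rewrite big_seq1.
  move=> x; rewrite inE => /eqP ->; left; left.
  exact: pinned_sub (marks_sub AB) _ qB.
case=> s [sr Qs]; apply: (pinned_not_fixing _ leQ sr Qs).
by have := set_mem (set_mem (valP Q)); case.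
Qed.

End Structures.

Theorem theorem6 (R : realType) (n : nat) (a : nat -> homeo R) (l r : nat -> R)
    (n_ge2 : (2 <= n)%N) (a_std : standard_generators n a l r) :
  exists Phi : set nat -> conf_chi0 n a,
    (forall A B : set nat, (Phi A <= Phi B)%O <-> A `<=` B) /\
    (forall A : set nat, ~ lamplike (r 0%N) (Phi A)).
Proof.
have [e /andP[e0 er] a0_linear] := gen0_linear n_ge2 a_std.
have t0 : 0 < Num.min 4^-1 (e / 4) by rewrite lt_min; apply/andP; split; lra.
have t1 : Num.min 4^-1 (e / 4) <= 4^-1 by rewrite ge_min lexx.
have te : 4 * Num.min 4^-1 (e / 4) <= e.
  have : Num.min 4^-1 (e / 4) <= e / 4 by rewrite ge_min lexx orbT.
  lra.
exact: (pinned_power_set n_ge2 a_std er a0_linear t0 t1 te).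
Qed.
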